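(* For each $c\in\mathbb N$ let $M^{(c)}=(M_{ji}^{(c)}:(j,i)\in\mathcal K)$ be the stationary vector of numbers of packets of each route at each queue in the queueing system at congestion level $c$, with congestion windows given by $G_i^{(c)}(k)=cG_i\big(\frac kc+\frac{d_i^{(c)}}c\big)$, $i\in\mathcal I$. For $m\in\mathbb R_+^K$ put $m_j=\sum_{i:j\in i}m_{ji}$, $\bar m_i=\sum_{j\in i}m_{ji}$, $$\beta_G(m)=\sum_{(j,i)\in\mathcal K:\,m_{ji}>0}m_{ji}\log\frac{m_{ji}C_j}{m_j}-\sum_{i\in\mathcal I}G_i(\bar m_i),\qquad \beta_G^*=\min_{m\in\mathbb R_+^K}\beta_G(m).$$ Then the sequence $\frac{M^{(c)}}{c}$, $c\in\mathbb N$, obeys a large deviations principle with good rate function $\beta_G(\cdot)-\beta_G^*$. That is, for all (Borel) $D\subset\mathbb R_+^K$, $$-\inf_{m\in D^\circ}(\beta_G(m)-\beta_G^* )\le\liminf_{c\to\infty}\frac1c\log\mathbb P\Big(\frac{M^{(c)}}{c}\in D\Big)\le\limsup_{c\to\infty}\frac1c\log\mathbb P\Big(\frac{M^{(c)}}{c}\in D\Big)\le-\inf_{m\in\bar D}(\beta_G(m)-\beta_G^* ),$$ where $D^\circ$ and $\bar D$ are the interior and closure of $D$ in $\mathbb R_+^K$.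
   Context: **Network.** $\mathcal J$ is a finite set of queues. $\mathcal I$ is a finite set of routes, each route $i\in\mathcal I$ being a non-empty subset of $\mathcal J$ together with an ordering $(j_1^i,\dots,j_{k_i}^i)$ of its elements. $\mathcal K=\{(j,i)\in\mathcal J\times\mathcal I: j\in i\}$, $I=|\mathcal I|$, $K=|\mathcal K|$. Each queue $j$ has capacity $C_j\in(0,\infty)$. For each queue $j$ and $n\ge1$, $(\gamma_j(l,n))_{l=1}^n$ and $(\delta_j(l,n))_{l=1}^n$ are probability vectors (service proportions and insertion probabilities of positions). **Queueing system at congestion level $c$.** A state is $s=(s^j:j\in\mathcal J)$, where $s^j=(i^j_1,\dots,i^j_{m_j})$ is a finite word of routes $i\ni j$ (the routes of the packets in positions $1,\dots,m_j$ of queue $j$). Let $m_{ji}$ be the number of occurrences of $i$ in $s^j$, so $m_j=\sum_{i:j\in i}m_{ji}$, and let $\bar m_i=\sum_{j\in i}m_{ji}$ (the state of congestion window $i$). The system is the continuous-time Markov chain with the following transitions (rates of different events leading to the same state are added): - injection: for each route $i$, with $j=j_1^i$ and $l=1,\dots,m_j+1$, a route $i$ packet is inserted in position $l$ of queue $j$ (packets in positions $l,\dots,m_j$ move to $l+1,\dots,m_j+1$) at rate $g_i^{(c)}(\bar m_i)\,\delta_j(l,m_j+1)$; - transfer: if $i^j_l=i$, $j=j^i_k$, $j'=j^i_{k+1}$, $1\le k\le k_i-1$, the packet in position $l$ of queue $j$ leaves (packets in positions $l+1,\dots,m_j$ move to $l,\dots,m_j-1$) and is inserted in position $l'\in\{1,\dots,m_{j'}+1\}$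 of queue $j'$ at rate $C_j\gamma_j(l,m_j)\,\delta_{j'}(l',m_{j'}+1)$; - acknowledgement: if $i^j_l=i$ and $j=j^i_{k_i}$, the packet in position $l$ of queue $j$ leaves the system at rate $C_j\gamma_j(l,m_j)$. Here $g_i^{(c)}(k)=e^{G_i^{(c)}(k+1)-G_i^{(c)}(k)}$ for $k\in\mathbb Z_+$. Stationary means started from its stationary distribution; $M^{(c)}$ is the vector of counts $m_{ji}$ under the stationary distribution. **Utilities and congestion windows.** For each $i$, $U_i$ is an increasing, strictly concave, differentiable real function on $(0,\infty)$ with $U_i'(\Lambda)\to\infty$ as $\Lambda\to0$. Define $G_i:\mathbb R_+\to[-\infty,\infty)$ by $$-G_i(\bar m_i)=\sup_{\lambda_i\in\mathbb R}\{U_i(e^{\lambda_i})-\bar m_i\lambda_i\}.$$ Assumption 1: $\lambda\mapsto U_i(e^\lambda)$ is strictly concave on $\mathbb R$. Assumption 2: $G_i$ is strictly concave, continuously differentiable on $(0,\infty)$, with derivative taking all values in $\mathbb R$. For each $i$, $(d_i^{(c)})_{c\in\mathbb N}$ is a bounded real sequence such that $G_i^{(c)}(k)=cG_i\big(\frac kc+\frac{d_i^{(c)}}c\big)$ is defined and finite for all $k\in\mathbb Z_+$. A good rate function is a $[0,\infty]$-valued function with compact sublevel sets. *)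

(* Defs.v *)
From HB Require Import structures.
From mathcomp Require Import all_boot all_order all_algebra.
From mathcomp Require Import all_classical all_reals all_analysis.
Set Implicit Arguments.
Unset Strict Implicit.
Unset Printing Implicit Defensive.
Import Order.TTheory GRing.Theory Num.Theory.
Import numFieldNormedType.Exports.

Local Open Scope classical_set_scope.
Local Open Scope ring_scope.

(* A route is a nonempty duplicate-free sequence of queues, given by its first
   queue and the remaining ones.  Queue positions are numbered from 0: position
   l of a queue of n packets is an ordinal of 'I_n, so [service j n l] is
   gamma_j(l+1, n) and [insertion j n l] is delta_j(l+1, n). *)
Record network (R : realType) := Network {
  queue : finType;
  route : finType;
  first_queue : route -> queue;
  next_queues : route -> seq queue;
  capacity : queue -> R;
  service : forall (j : queue) (n : nat), 'I_n -> R;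
  insertion : forall (j : queue) (n : nat), 'I_n -> R;
  path_uniq : forall i, uniq (first_queue i :: next_queues i);
  path_inj : injective (fun i => first_queue i :: next_queues i);
  capacity_gt0 : forall j, 0 < capacity j;
  serve_ge0 : forall j n (l : 'I_n), 0 <= service j l;
  serve_sum1 : forall j n, (0 < n)%N -> \sum_(l < n) service j l = 1;
  insert_ge0 : forall j n (l : 'I_n), 0 <= insertion j l;
  insert_sum1 : forall j n, (0 < n)%N -> \sum_(l < n) insertion j l = 1
}.

Section Network.
Variables (R : realType) (N : network R).

Definition route_path (i : route N) : seq (queue N) := first_queue i :: next_queues i.

Definition incidence := {p : queue N * route N | p.1 \in route_path p.2}.

(* Arbitrary words; [state] keeps those where a packet only sits in queues of
   its own route. *)
Definition config := {ffun queue N -> seq (route N)}.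

Definition state :=
  {s : config | [forall j, all (fun i => j \in route_path i) (s j)]}.

Definition packets (s : config) (j : queue N) (i : route N) : nat :=
  count_mem i (s j).

Definition in_flight (s : config) (i : route N) : nat :=
  (\sum_(j in route_path i) packets s j i)%N.

(* The queue visited after j on route i, None if j is the last one. *)
Definition next_queue (i : route N) (j : queue N) : option (queue N) :=
  onth (route_path i) (index j (route_path i)).+1.

Definition insert_at (i : route N) (j : queue N) (l : nat) (s : config) : config :=
  [ffun x => if x == j then take l (s j) ++ i :: drop l (s j) else s x].

Definition remove_at (j : queue N) (l : nat) (s : config) : config :=
  [ffun x => if x == j then take l (s j) ++ drop l.+1 (s j) else s x].

Section Chain.
Variable g : route N -> nat -> R.

(* The sum over all transition events e possible in configuration s of
   (rate of e) * F (configuration after e). *)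
Definition event_sum (s : config) (F : config -> R) : R :=
  (\sum_(i : route N) \sum_(l < (size (s (first_queue i))).+1)
     g i (in_flight s i) * insertion (first_queue i) l
       * F (insert_at i (first_queue i) l s))
  + \sum_(j : queue N) \sum_(l < size (s j))
      let i := tnth (in_tuple (s j)) l in
      match next_queue i j with
      | Some j' =>
          \sum_(l' < (size (s j')).+1)
            capacity j * service j l * insertion j' l'
              * F (insert_at i j' l' (remove_at j l s))
      | None => capacity j * service j l * F (remove_at j l s)
      end.

(* Off the diagonal this adds up the rates of the events leading from s to s';
   on the diagonal it is minus the total rate of leaving s. *)
Definition generator (s s' : state) : R :=
  event_sum (val s) (fun z => (z == val s')%:R - (s == s')%:R).

End Chain.

Definition is_pmf (p : state -> R) : Prop :=
  (forall s, 0 <= p s) /\ (\esum_(s in setT) (p s)%:E = 1)%E.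

(* P t s s' is the probability of being in s' at time t when started from s. *)
Definition is_transition_function (P : R -> state -> state -> R) : Prop :=
  [/\ forall t s, 0 <= t -> is_pmf (P t s),
      forall s s', P 0 s s' = (s == s')%:R
    & forall t u s s', 0 <= t -> 0 <= u ->
        ((P (t + u) s s')%:E = \esum_(z in setT) (P t s z * P u z s')%:E)%E].

(* If g i is nonincreasing, as for injection rates given by a concave window
   function, the generator is bounded and so determines P. *)
Definition is_network_chain (g : route N -> nat -> R)
    (P : R -> state -> state -> R) : Prop :=
  is_transition_function P /\
  forall s s',
    (P h s s' - (s == s')%:R) / h @[h --> 0^'+] --> generator g s s'.

Definition is_stationary (P : R -> state -> state -> R) (p : state -> R) : Prop :=
  is_pmf p /\
  forall t s', 0 <= t -> (\esum_(s in setT) (p s * P t s s')%:E = (p s')%:E)%E.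

(* R^K with its product topology; R_+^K is its subset [orthant]. *)
Definition vec := {ptws incidence -> R}.

Definition orthant : set vec := [set m : vec | forall k, 0 <= m k].

Definition scaled_counts (c : nat) (s : state) : vec :=
  fun k => (packets (val s) (val k).1 (val k).2)%:R / c%:R.

(* The law of M / c when the state has distribution p. *)
Definition scaled_law (p : state -> R) (c : nat) (D : set vec) : \bar R :=
  (\esum_(s in [set s | D (scaled_counts c s)]) (p s)%:E)%E.

Definition queue_total (m : vec) (j : queue N) : R :=
  \sum_(k : incidence | (val k).1 == j) m k.

Definition window_total (m : vec) (i : route N) : R :=
  \sum_(k : incidence | (val k).2 == i) m k.

Definition beta (G : route N -> R -> \bar R) (m : vec) : \bar R :=
  ((\sum_(k : incidence | 0 < m k)
      m k * ln (m k * capacity (val k).1 / queue_total m (val k).1))%:E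
   - \sum_(i : route N) G i (window_total m i))%E.

Definition beta_min (G : route N -> R -> \bar R) : \bar R :=
  ereal_inf [set beta G m | m in orthant].

End Network.

Section Utility.
Variable R : realType.

Definition strictly_concave_on (A : set R) (f : R -> R) : Prop :=
  forall x y t, A x -> A y -> x != y -> 0 < t < 1 ->
    t * f x + (1 - t) * f y < f (t * x + (1 - t) * y).

(* Utilities are real functions of which only the values on ]0, +oo[ matter. *)
Definition is_utility (U : R -> R) : Prop :=
  [/\ forall x y, 0 < x -> x < y -> U x < U y,
      strictly_concave_on [set x | 0 < x] U,
      forall x, 0 < x -> derivable U x 1
    & derive1 U x @[x --> 0^'+] --> +oo].

(* For negative m, outside the domain of the paper's G, the value is -oo. *)
Definition window_fun (U : R -> R) (m : R) : \bar R :=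
  (- ereal_sup [set (U (expR lam) - m * lam)%:E | lam in setT])%E.

Definition regular_window (G : R -> \bar R) : Prop :=
  let G' := derive1 (fun m => fine (G m)) in
  [/\ forall m, 0 < m -> G m \is a fin_num,
      strictly_concave_on [set m | 0 < m] (fun m => fine (G m)),
      forall m, 0 < m -> derivable (fun m => fine (G m)) m 1,
      forall m, 0 < m -> {for m, continuous G'}
    & forall y, exists2 m, 0 < m & G' m = y].

Definition window_arg (d : nat -> R) (c k : nat) : R :=
  k%:R / c%:R + d c / c%:R.

Definition scaled_window (G : R -> \bar R) (d : nat -> R) (c k : nat) : R :=
  c%:R * fine (G (window_arg d c k)).

Definition injection_rate (G : R -> \bar R) (d : nat -> R) (c k : nat) : R :=
  expR (scaled_window G d c k.+1 - scaled_window G d c k).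

End Utility.

Section LargeDeviations.
Variables (R : realType) (T : topologicalType) (X : set T).

Definition good_rate_function (J : T -> \bar R) : Prop :=
  (forall x, X x -> (0 <= J x)%E) /\
  forall a : R, compact [set x | X x /\ (J x <= a%:E)%E].

(* Interior and closure are relative to X; mu c is the law of the c-th term
   (the value at c = 0 is irrelevant) and lne 0 = -oo. *)
Definition large_deviations (mu : nat -> set T -> \bar R) (J : T -> \bar R) : Prop :=
  good_rate_function J /\
  forall D : set T, D `<=` X -> <<s [set A : set T | open A] >> D ->
    let u := fun c : nat => ((c%:R^-1)%:E * lne (mu c D))%E in
    [/\ (- ereal_inf [set J x | x in @interior (subspace X) D] <= limn_einf u)%E,
        (limn_einf u <= limn_esup u)%E
      & (limn_esup u <= - ereal_inf [set J x | x in @closure (subspace X) D])%E].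

End LargeDeviations.

(* Main.v *)
Require Import Defs.
From HB Require Import structures.
From mathcomp Require Import all_boot all_order all_algebra.
From mathcomp Require Import all_classical all_reals all_analysis.
From mathcomp Require Import ring lra.
Set Implicit Arguments.
Unset Strict Implicit.
Unset Printing Implicit Defensive.
Import Order.TTheory GRing.Theory Num.Theory.
Import numFieldNormedType.Exports.
Local Open Scope classical_set_scope.
Local Open Scope ring_scope.

(** Idea.  Weight a configuration by prod_i exp(G_i^(c)(number of route i packets))
    times prod_j C_j^(-length of queue j).  Transition by transition, this weight
    turns the rates of the network into those of the network run backwards (routes
    reversed, service and insertion probabilities exchanged), which has the same
    total rates; hence it is invariant.  As every configuration can drain to the
    empty one, it is the only finite invariant measure up to a factor, so the
    stationary law is proportional to it.

    The number of words with given letter counts is exp(entropy) up to subexponential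
    factors, so the states with counts c m have total weight about exp(- c beta(m)).
    The windows are suprema of affine functions, which makes beta lower
    semicontinuous and coercive, uniformly in the vanishing shifts d/c; a compactness
    argument plus summability of exp(- theta (number of packets)) over empirical
    types gives the upper bound.  The lower bound comes from the single lattice point
    floor(c m)/c. *)

(** * Words and letter counts *)

(** Stationarity is given for the transition function, not for the generator. Differentiating at
    time 0 passes only finite sums to the limit, so the stationary law is at first merely excessive:
    its inflow into a state is at most its outflow. By concavity the injection rates decrease in the
    window content, so at each level the jump rates are bounded, and summing over all states forces
    equality.

    The weight of a state splits exactly into [exp (- c * cost)] of its scaled counts and the
    maximal likelihoods of its words. Summed over the words of a given length, these likelihoods
    grow polynomially, so the upper bound needs no counting of words; only the lower bound uses
    Stirling.

    A window may be [-oo] at 0. For the upper bound any choice of slopes [lam] bounds the cost from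
    below by a function jointly continuous in counts and shifts. For the lower bound the windows
    must be bounded from below only near a point where [beta] is finite, which concavity provides.
    The normalizing constant is never computed: both bounds, applied to the whole orthant, show that
    it is [exp (c * beta_min)] up to factors [exp (c * eps)]. *)

Section Words.
Variables (R : realType) (I : finType).
Implicit Types (w : seq I) (x : I).

Lemma sum_count w : (\sum_x count_mem x w)%N = size w.
Proof.
elim: w => [|y w IHw] /=; first by rewrite big1.
rewrite big_split/= IHw -add1n; congr addn.
by rewrite (bigD1 y)//= eqxx big1// => x /negPf; rewrite eq_sym => ->.
Qed.

(** Induction on the length, sorting the permutations by their first letter [x]: passing from [w] to
    [rem x w] takes a factor [count_mem x w] out of the product of factorials, and these counts add
    up to the length. *)
Lemma multinomial_permutations w :
  (size (permutations w) * \prod_x (count_mem x w)`! = (size w)`!)%N.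
Proof.
have [n] := ubnP (size w); elim: n w => // n IHn w; rewrite ltnS => wn.
have [->|w0] := eqVneq w [::].
  by rewrite size_permutations// big1.
have w_gt0 : (0 < size w)%N by rewrite lt0n size_eq0.
rewrite (perm_size (permutationsE w_gt0)) size_allpairs_dep sumnE big_map.
rewrite big_distrl/=.
transitivity (\sum_(x <- undup w) count_mem x w * (size w).-1`!)%N.
  apply: eq_big_seq => x; rewrite mem_undup => xw.
  have -> : (\prod_y (count_mem y w)`! =
      count_mem x w * \prod_y (count_mem y (rem x w))`!)%N.
    rewrite (bigD1 x)//= [in RHS](bigD1 x)//= mulnA count_mem_rem eqxx.
    rewrite subn1; congr (_ * _)%N.
      have : (0 < count_mem x w)%N by rewrite -has_count has_pred1.
      by case: (count_mem x w).
    by apply: eq_bigr => y /negPf yx; rewrite count_mem_rem eq_sym yx subn0.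
  rewrite mulnCA IHn ?size_rem//.
  by rewrite prednK.
rewrite -big_distrl/= big_uniq ?undup_uniq//=.
have -> : (\sum_(x in undup w) count_mem x w = size w)%N.
  rewrite -[RHS]sum_count [RHS](bigID (mem (undup w)))/= [X in _ = (_ + X)%N]big1 ?addn0//.
  by move=> x; rewrite mem_undup => /count_memPn.
by rewrite -{1}(prednK w_gt0) -factS prednK.
Qed.

Lemma sum_tuple_prod (p : I -> R) n :
  \sum_(w : n.-tuple I) \prod_(x <- w) p x = (\sum_x p x) ^+ n.
Proof.
rewrite -[n in RHS]card_ord -prodr_const bigA_distr_bigA/=.
rewrite (reindex (fun f : {ffun 'I_n -> I} => [tuple f i | i < n])); last first.
  exists (fun t : n.-tuple I => [ffun i => tnth t i]) => t _.
    by apply/ffunP => i; rewrite ffunE tnth_mktuple.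
  by apply: eq_from_tnth => i; rewrite tnth_mktuple ffunE.
by apply: eq_bigr => f _; rewrite big_map big_enum.
Qed.

(* The maximal likelihood of w under i.i.d. sampling of letters. *)
Definition empirical w : R := \prod_(x <- w) ((count_mem x w)%:R / (size w)%:R).

Lemma empirical_ge0 w : 0 <= empirical w.
Proof. by apply: prodr_ge0 => x _; rewrite divr_ge0. Qed.

(** Method of types: the likelihood of [w] is its probability under i.i.d. letters with frequencies
    [k / n], where [k] is the type of [w]. For each fixed type these probabilities sum to at most 1
    over all words, and there are at most [(n + 1) ^ #|I|] types. *)
Lemma sum_empirical_tuple n :
  \sum_(w : n.-tuple I) empirical w <= (n.+1%:R) ^+ #|I|.
Proof.
pose type (k : {ffun I -> 'I_n.+1}) : bool := (\sum_x k x == n)%N.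
apply: (@le_trans _ _ (\sum_(w : n.-tuple I) \sum_(k : {ffun I -> 'I_n.+1} | type k)
    \prod_(x <- w) ((k x)%:R / n%:R : R))).
  apply: ler_sum => w _; have lt x : (count_mem x w < n.+1)%N.
    by rewrite ltnS -[leqRHS](size_tuple w) count_size.
  pose k0 : {ffun I -> 'I_n.+1} := [ffun x => Ordinal (lt x)].
  have tk0 : type k0.
    rewrite /type; apply/eqP; rewrite -[RHS](size_tuple w) -sum_count.
    by apply: eq_bigr => x _; rewrite ffunE.
  rewrite (bigD1 k0)//=.
  have -> : empirical w = \prod_(x <- w) ((k0 x)%:R / n%:R).
    by apply: eq_bigr => x _; rewrite ffunE/= size_tuple.
  by rewrite lerDl sumr_ge0// => k _; apply: prodr_ge0 => x _; rewrite divr_ge0.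
rewrite exchange_big/=.
apply: (@le_trans _ _ (\sum_(k : {ffun I -> 'I_n.+1}) 1)); last first.
  by rewrite sumr_const card_ffun card_ord -natrX.
rewrite [leLHS]big_mkcond/=; apply: ler_sum => k _; case: ifPn => // /eqP tk.
rewrite sum_tuple_prod -mulr_suml -natr_sum tk.
(* For [n = 0] the quotient is 0, but its power 0 is 1. *)
by case: (n) => [|m]; rewrite ?expr0// divff ?expr1n// pnatr_eq0.
Qed.

Lemma sum_bseq_le (L : nat) (f : seq I -> R) : (forall w, 0 <= f w) ->
  \sum_(w : L.-bseq I) f w <= \sum_(n < L.+1) \sum_(w : n.-tuple I) f w.
Proof.
move=> f0; rewrite (partition_big (fun w : L.-bseq I => inord (size w) : 'I_L.+1) xpredT)//=.
apply: ler_sum => n _.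
rewrite (reindex_omap (fun t : n.-tuple I => insub_bseq L t) (fun w : L.-bseq I => insub (val w))); last first.
  by move=> w /eqP <-; rewrite insubT ?inordK ?ltnS ?size_bseq//= => _; rewrite /insub_bseq valKd.
rewrite [leLHS]big_mkcond/=; apply: ler_sum => t _; case: ifP => // _.
by rewrite insubdK// unfold_in/= size_tuple -ltnS.
Qed.

Lemma sum_empirical (eta : R) : 0 < eta ->
  exists S : R, forall L, \sum_(w : L.-bseq I) empirical w * expR (- eta * (size w)%:R) <= S.
Proof.
(* [a] satisfies [K * a <= eta / 2], and [c] satisfies [n + 1 <= c * (1 + a * n) <= c * expR (a *
   n)]. The polynomial number of types thus uses up at most half of the exponential decay and leaves
   a geometric series of ratio [r]. *)
move=> eta0; pose K := #|I|; pose a := eta / (2 * K.+1%:R).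
have a0 : 0 < a by rewrite divr_gt0// mulr_gt0.
pose c := Num.max 1 a^-1; pose r := expR (- eta / 2).
have c1 : 1 <= c by rewrite le_max lexx.
have r1 : r < 1 by rewrite -expR0 ltr_expR mulNr oppr_lt0 divr_gt0.
have r0 : 0 < r := expR_gt0 _.
exists (c ^+ K * (1 - r)^-1) => L.
apply: le_trans (@sum_bseq_le L (fun w => empirical w * expR (- eta * (size w)%:R)) _) _.
  by move=> w; rewrite mulr_ge0 ?empirical_ge0 ?expR_ge0.
have term n : \sum_(w : n.-tuple I) empirical w * expR (- eta * (size w)%:R) <= c ^+ K * r ^+ n.
  under eq_bigr do rewrite size_tuple.
  rewrite -mulr_suml.
  apply: (@le_trans _ _ ((c * expR (a * n%:R)) ^+ K * expR (- eta * n%:R))).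
    rewrite ler_pM2r ?expR_gt0//; apply: le_trans (sum_empirical_tuple n) _.
    rewrite lerXn2r ?nnegrE ?mulr_ge0 ?expR_ge0 ?(le_trans _ c1)//.
    apply: (@le_trans _ _ (c * (1 + a * n%:R))); last first.
      by rewrite ler_wpM2l ?expR_ge1Dx ?(le_trans _ c1).
    rewrite mulrDr mulr1 mulrA -addn1 natrD addrC lerD// ler_peMl//.
    by rewrite -(mulVf (lt0r_neq0 a0)) ler_pM2r// le_max lexx orbT.
  rewrite exprMn -mulrA ler_pM2l ?exprn_gt0 ?(lt_le_trans _ c1)//.
  rewrite -!expRM_natl -expRD ler_expR -subr_ge0.
  have -> : n%:R * (- eta / 2) - (K%:R * (a * n%:R) + - eta * n%:R) =
      n%:R * (eta / 2 * (1 - K%:R / K.+1%:R)).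
    have : K.+1%:R != 0 :> R by [].
    by rewrite /a; move: (K.+1%:R : R) => k1 k10; field.
  rewrite mulr_ge0//; apply: mulr_ge0; first by rewrite divr_ge0// ltW.
  by rewrite subr_ge0 ler_pdivrMr// mul1r ler_nat.
apply: (@le_trans _ _ (\sum_(n < L.+1) c ^+ K * r ^+ n)).
  by apply: ler_sum => n _; exact: term.
rewrite -mulr_sumr ler_pM2l ?exprn_gt0 ?(lt_le_trans _ c1)//.
rewrite -[leRHS]mul1r ler_pdivlMr ?subr_gt0//.
have := subrX1 r L.+1; rewrite -opprB => /(congr1 -%R); rewrite opprK -mulNr opprB mulrC => <-.
by rewrite lerBlDr lerDl exprn_ge0// ltW.
Qed.

End Words.

(** * Stirling bounds and logarithmic limits *)

Lemma ln_fact_ge (R : realType) n : n%:R * ln n%:R - n%:R <= ln n`!%:R :> R.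
Proof.
elim: n => [|n IHn]; first by rewrite mul0r fact0 ln1 subrr.
rewrite factS natrM lnM ?posrE ?ltr0n ?fact_gt0//.
have n1 : 0 < n.+1%:R :> R by [].
suff : n%:R * (ln n.+1%:R - ln n%:R) <= 1 :> R.
  by move: IHn; set a := ln n.+1%:R; rewrite -[n.+1%:R]natr1; lra.
case: n {IHn n1} => [|n]; first by rewrite mul0r.
have n1 : 0 < n.+1%:R :> R by [].
rewrite -ln_div ?posrE// -ler_pdivlMl// mulr1.
have -> : n.+2%:R / n.+1%:R = 1 + n.+1%:R^-1 :> R.
  by rewrite -[n.+2%:R]natr1 mulrDl divff ?mul1r// gt_eqF.
by apply: le_ln1Dx; rewrite (lt_trans (ltrN10 _))// invr_gt0.
Qed.

(** The induction step is [ln (1 - 1 / (n + 2)) <= - 1 / (n + 2)]. Evaluating [x * ln x] at [n.+1]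
    keeps the bound true from [n = 0] on; the shift by one disappears after division by [c]. *)
Lemma ln_fact_le (R : realType) n : ln n`!%:R <= n.+1%:R * ln n.+1%:R - n%:R :> R.
Proof.
elim: n => [|n IHn]; first by rewrite fact0 !ln1 mulr0 subrr.
rewrite factS natrM lnM ?posrE ?ltr0n ?fact_gt0//.
suff : 1 <= n.+2%:R * (ln n.+2%:R - ln n.+1%:R) :> R.
  move: IHn; set a := ln n.+2%:R; set b := ln n.+1%:R.
  by rewrite -[n.+2%:R]natr1 -[n.+1%:R]natr1; lra.
have n1 : 0 < n.+1%:R :> R by []. have n2 : 0 < n.+2%:R :> R by [].
rewrite -opprB mulrN lerNr -ln_div ?posrE// -ler_pdivlMl// mulrN1.
have -> : n.+1%:R / n.+2%:R = 1 + - n.+2%:R^-1 :> R.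
  by rewrite -[n.+1%:R](addrK 1) natr1 mulrBl divff ?mul1r// gt_eqF.
by apply: le_ln1Dx; rewrite ltrN2 invf_lt1// ltr1n.
Qed.

(* As ln x = 0 for x <= 0, the function x ln x is continuous on the whole line. *)
Lemma continuous_xln (R : realType) : continuous (fun x : R => x * ln x).
Proof.
move=> x; have [x0|x0|->] := ltgtP x 0.
- rewrite /continuous_at (ln0 (ltW x0)) mulr0.
  apply: cvg_near_cst; near=> y; rewrite ln0 ?mulr0//.
  by near: y; apply: (@cvgr_le _ _ (nbhs x) _ id x _ 0 x0); exact: cvg_id.
- by apply: cvgM; [exact: cvg_id|exact: continuous_ln].
- rewrite /continuous_at mul0r; apply/cvgr0Pnorm_le => e e0.
  near=> y; have [y0|y0] := leP y 0; first by rewrite (ln0 y0) mulr0 normr0 ltW.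
  have yd : `|y| < Num.min 1 ((e / 2) ^+ 2).
    near: y; apply: (@nbhs0_lt _ R^o); rewrite lt_min ltr01/=.
    by rewrite exprn_gt0// divr_gt0.
  move: yd; rewrite gtr0_norm// lt_min => /andP[y1 ye].
  (* Write [y] as the square of its root: from [- ln (sqrt y) <= 1 / sqrt y] follows
     [|y * ln y| <= 2 * sqrt y <= e]. *)
  have sy0 : 0 < Num.sqrt y by rewrite sqrtr_gt0.
  have sye : Num.sqrt y <= e / 2.
    by rewrite -[leRHS]ger0_norm ?divr_ge0 ?(ltW e0)// -sqrtr_sqr ler_sqrt ?sqr_ge0// ltW.
  have lny : - ln (Num.sqrt y) <= (Num.sqrt y)^-1.
    by rewrite -lnV ?posrE//; apply/ltW/ln_sublinear; rewrite invr_gt0.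
  rewrite ler0_norm; last by rewrite mulr_ge0_le0 ?(ltW y0) ?ln_le0 ?(ltW y1).
  rewrite -{1 2}[y]sqr_sqrtr ?(ltW y0)// lnXn// -mulrN -mulNrn.
  apply: (@le_trans _ _ (Num.sqrt y ^+ 2 * ((Num.sqrt y)^-1 *+ 2))).
    by rewrite ler_wpM2l ?sqr_ge0// lerMn2r lny orbT.
  rewrite mulrnAr expr2 -mulrA divff ?gt_eqF// mulr1 -mulr_natr.
  by rewrite -ler_pdivlMr.
Unshelve. all: by end_near. Qed.

Lemma cvg_inv_nat (R : realType) : (fun n : nat => n%:R^-1 : R) @ \oo --> (0 : R).
Proof. by rewrite -cvg_shiftS; exact: cvg_harmonic. Qed.

(** This is [- x * ln x] along [x = 1 / n], and [x * ln x] is continuous at 0. *)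
Lemma cvg_ln_div (R : realType) : (fun n : nat => ln n%:R / n%:R : R) @ \oo --> (0 : R).
Proof.
have := @continuous_xln R 0; rewrite /continuous_at mul0r => xln0.
have := cvgN (cvg_comp _ _ (@cvg_inv_nat R) xln0); rewrite oppr0 => E; refine (cvg_trans _ (E _)).
apply: near_eq_cvg; exists 1%N => // n /= n1.
have n0 : 0 < n%:R :> R by rewrite ltr0n.
change (- ((n%:R : R)^-1 * ln (n%:R : R)^-1) = ln n%:R / n%:R).
by rewrite lnV ?posrE// mulrN opprK mulrC.
Qed.

(** * Excessive measures *)

Section Esum.
Variables (R : realType) (T : choiceType).
Implicit Types (f g : T -> \bar R) (A : set T).

Lemma sum_le_esum A f (r : seq T) : uniq r -> {in r, forall x, A x} ->
  (\sum_(x <- r) f x <= \esum_(x in A) f x)%E.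
Proof.
move=> ur rA; apply: esum_ge; exists [set` r] => //.
by rewrite fsbig_seq.
Qed.

Lemma esum_le A f (b : \bar R) :
  (forall r : seq T, uniq r -> {in r, forall x, A x} ->
     (\sum_(x <- r) f x <= b)%E) ->
  (\esum_(x in A) f x <= b)%E.
Proof.
move=> bnd; apply: ge_ereal_sup => _ [X [finX XA] <-].
rewrite fsbig_finite//=; apply: bnd => [|x]; first exact: finmap.fset_uniq.
by rewrite in_fset_set// inE; exact: XA.
Qed.

(** One inequality holds for every nonnegative factor by finite sums; applied to [c] and to [c^-1]
    it gives both directions. *)
Lemma esumZl A f (c : R) : 0 <= c -> (forall x, 0 <= f x)%E ->
  (\esum_(x in A) (c%:E * f x) = c%:E * \esum_(x in A) f x)%E.
Proof.
move=> c0 f0.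
have le_esumZl (a : R) (h : T -> \bar R) : 0 <= a -> (forall x, 0 <= h x)%E ->
    (\esum_(x in A) (a%:E * h x) <= a%:E * \esum_(x in A) h x)%E.
  move=> a0 h0; apply: esum_le => r ur rA.
  by rewrite -ge0_sume_distrr// lee_wpmul2l//; exact: sum_le_esum.
have [->|cn0] := eqVneq c 0; first by rewrite mul0e esum1// => x _; rewrite mul0e.
apply/eqP; rewrite eq_le le_esumZl//=.
rewrite -[leRHS]mul1e -(divff cn0) EFinM -muleA lee_wpmul2l ?lee_fin//.
rewrite [X in (esum A X <= _)%E](_ : _ = fun x => (c^-1)%:E * (c%:E * f x))%E.
  by apply: le_esumZl; rewrite ?invr_ge0// => x; rewrite mule_ge0.
by apply/funext => x; rewrite muleA -EFinM mulVf// mul1e.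
Qed.

Lemma esum_eq_le f g : (forall x, 0 <= f x)%E -> (forall x, f x <= g x)%E ->
  (\esum_(x in setT) g x < +oo)%E ->
  (\esum_(x in setT) f x = \esum_(x in setT) g x)%E -> f =1 g.
Proof.
move=> f0 fg goo efg x; apply/eqP; rewrite eq_le fg/= leNgt; apply/negP => fgx.
have g0 y : (0 <= g y)%E := le_trans (f0 y) (fg y).
move: goo efg; rewrite (esumID [set x] setT)// (esumID [set x] setT f)//.
rewrite setTI !esum_set1//; set r := \esum_(_ in _) _; set r' := \esum_(_ in _) _ => goo.
apply/eqP; rewrite lt_eqF//; apply: lte_leD => //.
- rewrite ge0_fin_numE ?esum_ge0//.
  by apply: le_lt_trans goo; rewrite -[leLHS]add0e leeD// le_esum.
- by apply: le_esum.
Qed.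

End Esum.

(* A continuous-time chain is given by its rates [q], its total jump rates [qb]
   (self-loops included) and an excessive measure by [nu q <= nu qb]. *)
Section Excessive.
Variables (R : realType) (T : choiceType) (q : T -> T -> R) (qb : T -> R).
Hypothesis q_ge0 : forall s s', 0 <= q s s'.
Hypothesis q_sum : forall s, (\esum_(s' in setT) (q s s')%:E = (qb s)%:E)%E.
Implicit Types nu : T -> R.

Definition excessive nu := (forall s, 0 <= nu s) /\ forall s',
  (\esum_(s in setT) (nu s * q s s')%:E <= (nu s' * qb s')%:E)%E.

Definition invariant_measure nu := (forall s, 0 <= nu s) /\ forall s',
  (\esum_(s in setT) (nu s * q s s')%:E = (nu s' * qb s')%:E)%E.

Lemma total_rate_ge0 s : 0 <= qb s.
Proof. by rewrite -lee_fin -q_sum esum_ge0// => x _; rewrite lee_fin. Qed.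

(* Summing nu q <= nu qb over all states gives equal finite masses. *)
Lemma excessive_invariant (L : R) nu : (forall s, qb s <= L) ->
  (\esum_(s in setT) (nu s)%:E < +oo)%E -> excessive nu ->
  invariant_measure nu.
Proof.
move=> qL nuoo [nu0 nue]; split=> // s'; move: s'.
apply: esum_eq_le => //.
- by move=> s'; apply: esum_ge0 => s _; rewrite lee_fin mulr_ge0.
- have [s0|noT] := pselect (exists s : T, True); last first.
    by rewrite esum1// => s _; case: noT; exists s.
  have L0 : 0 <= L by have [s _] := s0; exact: le_trans (total_rate_ge0 s) _.
  apply: (@le_lt_trans _ _ (L%:E * \esum_(s in setT) (nu s)%:E)%E); last first.
    by rewrite lte_mul_pinfty// lee_fin.
  rewrite -esumZl//.
  by apply: le_esum => s _; rewrite -EFinM lee_fin mulrC ler_wpM2r.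
- rewrite esum_esum; last by move=> i j _ _; rewrite lee_fin mulr_ge0.
  pose E := @esum_esum R T T setT (fun=> setT) (fun s s' => (nu s * q s s')%:E).
  transitivity (\esum_(s in setT) \esum_(s' in setT) (nu s * q s s')%:E)%E.
    rewrite E; last by move=> i j _ _; rewrite lee_fin mulr_ge0.
    rewrite (@reindex_esum _ _ _ [set k : T * T | True /\ True] _ (fun k => (k.2, k.1)))//.
    split=> [[a b]//|[a b] [a' b'] _ _ [-> ->]//|[a b] _]; by exists (b, a).
  apply: eq_esum => s _; under eq_esum do rewrite EFinM.
  rewrite esumZl ?q_sum//; by move=> s'; rewrite lee_fin.
Qed.

Variable o : T.
(** The form in which irreducibility enters: an excessive measure that charges a state charges
    everything reachable from it, so it is enough that [o] can be reached from everywhere. *)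
Hypothesis reach : forall nu, excessive nu -> nu o = 0 -> forall s, nu s = 0.

(** The inflow of [nu] is that of [nu - mu] plus the inflow of [mu], which equals the real number
    [mu s' * qb s'] and can be subtracted on both sides. An inequality for [mu] would not do. *)
Lemma excessiveB nu mu : excessive nu -> invariant_measure mu ->
  (forall s, mu s <= nu s) -> excessive (fun s => nu s - mu s).
Proof.
move=> [nu0 nue] [mu0 mui] munu; split=> [s|s']; first by rewrite subr_ge0.
have : (\esum_(s in setT) ((nu s - mu s) * q s s')%:E + (mu s' * qb s')%:E <=
  (nu s' * qb s')%:E)%E.
  rewrite -mui -esumD; last 2 first.
  - by move=> s _; rewrite lee_fin mulr_ge0// subr_ge0.
  - by move=> s _; rewrite lee_fin mulr_ge0.
  apply: le_trans (nue s'); apply: le_esum => s _.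
  by rewrite -EFinD -mulrDl subrK.
by rewrite -leeBrDr// -EFinB -mulrBl.
Qed.

(* [min p (a w)] is excessive and finite, hence invariant. *)
Lemma stationary_unique (L : R) p w : (forall s, qb s <= L) ->
  excessive p -> (\esum_(s in setT) (p s)%:E = 1)%E ->
  invariant_measure w -> (forall s, 0 < w s) ->
  exists2 a : R, 0 < a & forall s, p s = a * w s.
Proof.
(* With this [a] the measures [p], [a * w] and their minimum [mu] agree at [o]. As [mu] is
   invariant, [p - mu] is excessive and vanishes by [reach]; so [p] itself is invariant and lies
   below [a * w], and [reach] also kills [a * w - p]. *)
move=> qL pe p1 wi w0; pose a := p o / w o.
have a0 : 0 <= a by rewrite divr_ge0 ?(proj1 pe) ?ltW.
have awi : invariant_measure (fun s => a * w s).
  split=> [s|s']; first by rewrite mulr_ge0// ltW.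
  under eq_esum do rewrite -mulrA EFinM.
  rewrite esumZl//; first by rewrite (proj2 wi) -EFinM mulrA.
  by move=> s; rewrite lee_fin mulr_ge0// ltW.
have aw0 s : 0 <= a * w s := proj1 awi s.
pose mu s := Num.min (p s) (a * w s).
have mue : excessive mu.
  split=> [s|s']; first by rewrite le_min (proj1 pe) aw0.
  rewrite /mu minr_pMl ?total_rate_ge0// EFin_min le_min; apply/andP; split.
    apply: le_trans (proj2 pe s'); apply: le_esum => s _.
    by rewrite lee_fin ler_wpM2r// ge_min lexx.
  rewrite -(proj2 awi s'); apply: le_esum => s _.
  by rewrite lee_fin ler_wpM2r// ge_min lexx orbT.
have mui : invariant_measure mu.
  apply: (excessive_invariant qL) => //; apply: (@le_lt_trans _ _ 1%E); last by rewrite ltry.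
  by rewrite -p1; apply: le_esum => s _; rewrite lee_fin ge_min lexx.
have pmu s : p s = mu s.
  apply/eqP; rewrite -subr_eq0; apply/eqP; move: s.
  apply: reach; first by apply: excessiveB => // s; rewrite ge_min lexx.
  by rewrite /mu /a mulfVK ?gt_eqF// minxx subrr.
have paw s : p s = a * w s.
  apply/esym/eqP; rewrite -subr_eq0; apply/eqP; move: s.
  apply: reach; last by rewrite /a mulfVK ?gt_eqF// subrr.
  apply: (@excessiveB (fun s => a * w s) p).
  - by split=> // s'; rewrite (proj2 awi).
  - by rewrite (_ : p = mu)//; apply/funext.
  - by move=> s; rewrite pmu ge_min lexx orbT.
exists a => //; rewrite lt_neqAle a0 andbT; apply/eqP => a_eq0.
move/eqP: p1; rewrite esum1 ?eqe ?(eq_sym 0) ?oner_eq0// => s _.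
by rewrite paw -a_eq0 mul0r.
Qed.

End Excessive.

(** * The stationary law of the network *)

Section Configurations.
Variables (R : realType) (N : network R).
Implicit Types (s : config N) (i : route N) (j : queue N).

Lemma onth_size (T : eqType) (r : seq T) l x : onth r l = Some x -> (l < size r)%N.
Proof. by rewrite ltnNge; case: leqP => // /onth_default ->. Qed.

Lemma onth_cat_cons (T : eqType) (r : seq T) l x : onth r l = Some x ->
  take l r ++ x :: drop l.+1 r = r.
Proof.
elim: r l => [|y r IHr] [|l] //=; first by move=> [->]; rewrite drop0.
by move=> /IHr ->.
Qed.

Lemma remove_insert i j l s : (l <= size (s j))%N ->
  remove_at j l (insert_at i j l s) = s.
Proof.
move=> lj; apply/ffunP => x; rewrite !ffunE; case: eqP => [->|//]; rewrite eqxx.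
have szt : size (take l (s j)) = l by rewrite size_take; case: ltngtP lj.
rewrite take_size_cat// drop_cat szt ltnNge leqnSn/= subSnn/= drop0.
by rewrite cat_take_drop.
Qed.

Lemma insert_remove i j l s : onth (s j) l = Some i ->
  insert_at i j l (remove_at j l s) = s.
Proof.
move=> lj; apply/ffunP => x; rewrite !ffunE; case: eqP => [->|//]; rewrite eqxx.
have szt : size (take l (s j)) = l by rewrite size_take (onth_size lj).
by rewrite take_size_cat// drop_size_cat// onth_cat_cons.
Qed.

Lemma onth_insert i j l s : (l <= size (s j))%N ->
  onth (insert_at i j l s j) l = Some i.
Proof.
move=> lj; rewrite ffunE eqxx.
have szt : size (take l (s j)) = l by rewrite size_take; case: ltngtP lj.
by rewrite onth_cat szt ltnn subnn.
Qed.

(** The commutative monoid is arbitrary because the identity serves the product in [weight], the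
    sums in [in_flight] and [remaining_hops], and the conjunction in [valid]. *)
Lemma big_insert_at (V : Type) (idx : V) (op : Monoid.com_law idx)
    (f : queue N -> route N -> V) i j l s :
  \big[op/idx]_x \big[op/idx]_(y <- insert_at i j l s x) f x y =
  op (f j i) (\big[op/idx]_x \big[op/idx]_(y <- s x) f x y).
Proof.
rewrite (bigD1 j)//= [in RHS](bigD1 j)//= Monoid.mulmA; congr (op _ _).
  rewrite ffunE eqxx big_cat/= big_cons Monoid.mulmCA -big_cat/=.
  by rewrite cat_take_drop.
by apply: eq_bigr => x /negPf xj; rewrite ffunE xj.
Qed.

Lemma big_remove_at (V : Type) (idx : V) (op : Monoid.com_law idx)
    (f : queue N -> route N -> V) i j l s : onth (s j) l = Some i ->
  \big[op/idx]_x \big[op/idx]_(y <- s x) f x y =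
  op (f j i) (\big[op/idx]_x \big[op/idx]_(y <- remove_at j l s x) f x y).
Proof. by move=> sjl; rewrite -(big_insert_at _ _ _ _ l) insert_remove. Qed.

Lemma size_insert_at i j j' l s :
  size (insert_at i j l s j') = ((j' == j) + size (s j'))%N.
Proof.
rewrite ffunE; case: eqP => [->|//].
by rewrite size_cat/= addnS -size_cat cat_take_drop.
Qed.

Lemma size_remove_at i j j' l s : onth (s j) l = Some i ->
  size (s j') = ((j' == j) + size (remove_at j l s j'))%N.
Proof. by move=> sjl; rewrite -[in LHS](insert_remove sjl) size_insert_at. Qed.

Lemma in_flightE s i :
  in_flight s i = (\sum_j \sum_(x <- s j) ((j \in route_path i) && (x == i)))%N.
Proof.
rewrite /in_flight big_mkcond/=; apply: eq_bigr => j _; case: (j \in _) => /=.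
  by rewrite /packets -sum1_count big_mkcond; apply: eq_bigr => x _ /=; case: eqP.
by rewrite big1.
Qed.

Lemma in_flight_insert i i' j l s : j \in route_path i ->
  in_flight (insert_at i j l s) i' = ((i == i') + in_flight s i')%N.
Proof.
move=> ji; rewrite !in_flightE big_insert_at/=; congr (_ + _)%N.
by case: eqP => [<-|_]; rewrite ?ji ?andbT ?andbF.
Qed.

Definition valid s := [forall j, all (fun i => j \in route_path i) (s j)].

Lemma valid_insert i j l s : j \in route_path i ->
  valid (insert_at i j l s) = valid s.
Proof.
move=> ji.
have E s' : valid s' = \big[andb/true]_x \big[andb/true]_(y <- s' x) (x \in route_path y).
  by rewrite big_andE; apply: eq_forallb => x; rewrite big_all.
by rewrite !E big_insert_at/= ji.
Qed.

Lemma valid_onth s i j l : valid s -> onth (s j) l = Some i -> j \in route_path i.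
Proof.
move=> /forallP/(_ j) + sjl; rewrite -(onth_cat_cons sjl) all_cat/=.
by move=> /and3P[].
Qed.

Lemma valid_remove s i j l : valid s -> onth (s j) l = Some i ->
  valid (remove_at j l s).
Proof.
move=> vs sjl; move: (vs); rewrite -[in X in X -> _](insert_remove sjl).
by rewrite valid_insert// (valid_onth vs sjl).
Qed.

End Configurations.

(** * Single events and their reversals *)

Section Flows.
Variables (R : realType) (N : network R) (g W : route N -> nat -> R).
Hypothesis W_succ : forall i k, W i k.+1 = W i k * g i k.
Implicit Types (s : config N) (i : route N) (j : queue N).
Implicit Types (F : config N -> R) (gam del : queue N -> nat -> nat -> R).

(** The kernels are arguments because time reversal exchanges them. They take natural numbers
    instead of ordinals, so that one position can be read both before and after an event, when the
    queue lengths differ. *)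
Definition inject del s i j F : R :=
  \sum_(l < (size (s j)).+1)
    g i (in_flight s i) * del j (size (s j)).+1 l * F (insert_at i j l s).

Definition depart gam s i j F : R :=
  \sum_(l < size (s j) | onth (s j) l == Some i)
    capacity j * gam j (size (s j)) l * F (remove_at j l s).

Definition transfer gam del s i j j' F : R :=
  \sum_(l < size (s j) | onth (s j) l == Some i)
    \sum_(l' < (size (s j')).+1)
      capacity j * gam j (size (s j)) l * del j' (size (s j')).+1 l'
      * F (insert_at i j' l' (remove_at j l s)).

Definition weight s : R :=
  (\prod_i W i (in_flight s i)) * \prod_j \prod_(x <- s j) (capacity j)^-1.

(** The local identity behind every reversal: an insertion multiplies the weight by the injection
    rate over the capacity. *)
Lemma weight_insert i j l s : j \in route_path i ->
  weight (insert_at i j l s) * capacity j = weight s * g i (in_flight s i).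
Proof.
move=> ji; rewrite /weight big_insert_at/=.
rewrite (bigD1 i)//= in_flight_insert// eqxx add1n W_succ.
rewrite [in RHS](bigD1 i)//=.
under eq_bigr => k /negPf ki do rewrite in_flight_insert// eq_sym ki.
have := lt0r_neq0 (capacity_gt0 j).
by set C := capacity j; set P := \prod_(_ | _) _; move=> C0; field.
Qed.

Let pt s : config N -> R := fun z => (z == s)%:R.

(** An injection at position [l] is undone by the departure from position [l], with [kap] read as
    insertion probability one way and as service proportion the other way. Unless the lengths of
    queue [j] differ by one, both sides are 0; otherwise the two sums run over the same
    positions. *)
Lemma inject_depart kap s s' i j : j \in route_path i ->
  weight s * inject kap s i j (pt s') = weight s' * depart kap s' i j (pt s).
Proof.
move=> ji; have [e|ne] := eqVneq (size (s' j)) (size (s j)).+1; last first.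
  rewrite /inject /depart !big1 ?mulr0// => l.
    move=> /eqP sjl; rewrite /pt; case: eqP => [E|]; last by rewrite mulr0.
    by case/eqP: ne; rewrite (size_remove_at j sjl) eqxx E.
  move=> _; rewrite /pt; case: eqP => [E|]; last by rewrite mulr0.
  by case/eqP: ne; rewrite -E size_insert_at eqxx.
rewrite /inject /depart e !big_distrr/= [RHS]big_mkcond/=; apply: eq_bigr => l _.
rewrite /pt; case: eqP => [E|NE].
  have ls : (l <= size (s j))%N by rewrite -ltnS.
  rewrite -E onth_insert// eqxx remove_insert// eqxx !mulr1.
  by rewrite !mulrA weight_insert.
case: eqP => [sjl|]; last by rewrite !mulr0.
by case: eqP => [E|]; rewrite ?mulr0//; case: NE; have := insert_remove sjl; rewrite E.
Qed.

(** A move from [l] in [j] to [l'] in [j'] is undone by the move from [l'] to [l]. Both pass through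
    the same configuration without the packet, and two uses of [weight_insert] there give [weight s
    * capacity j = weight s' * capacity j']. *)
Lemma transfer_rev gam del s s' i j j' : j != j' ->
  j \in route_path i -> j' \in route_path i ->
  weight s * transfer gam del s i j j' (pt s') =
  weight s' * transfer del gam s' i j' j (pt s).
Proof.
have szE (z z' : config N) k k' l l' : k != k' -> onth (z k) l = Some i ->
    insert_at i k' l' (remove_at k l z) = z' ->
    size (z k) = (size (z' k)).+1 /\ size (z' k') = (size (z k')).+1.
  move=> kk' zkl <-; split.
    by rewrite size_insert_at (negPf kk') (size_remove_at k zkl) eqxx.
  by rewrite size_insert_at eqxx (size_remove_at k' zkl) eq_sym (negPf kk').
have mv (z z' : config N) k k' l l' : k != k' -> (l' <= size (z k'))%N -> onth (z k) l = Some i ->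
    insert_at i k' l' (remove_at k l z) = z' ->
    [/\ onth (z' k') l' = Some i, insert_at i k l (remove_at k' l' z') = z
      & remove_at k' l' z' = remove_at k l z].
  move=> kk' lz zkl <-.
  have ls : (l' <= size (remove_at k l z k'))%N.
    by move: lz; rewrite (size_remove_at k' zkl) eq_sym (negPf kk').
  by rewrite onth_insert// remove_insert// insert_remove.
move=> jj' ji j'i; have j'j : j' != j by rewrite eq_sym.
have [/andP[/eqP e /eqP e']|ne] := boolP ((size (s j) == (size (s' j)).+1)
    && (size (s' j') == (size (s j')).+1)); last first.
  rewrite /transfer !big1 ?mulr0// => l /eqP sjl; rewrite big1// => l' _; rewrite /pt.
    case: eqP => [E|]; rewrite ?mulr0//.
    by have [e' e] := szE _ _ _ _ _ _ j'j sjl E; case/negP: ne; rewrite e e' !eqxx.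
  case: eqP => [E|]; rewrite ?mulr0//.
  by have [e' e] := szE _ _ _ _ _ _ jj' sjl E; case/negP: ne; rewrite e e' !eqxx.
rewrite /transfer e e' !big_distrr/= big_mkcond/= [RHS]big_mkcond/=.
pose A (l l' : nat) := (onth (s j) l == Some i) && (insert_at i j' l' (remove_at j l s) == s').
transitivity (\sum_(l < (size (s' j)).+1) \sum_(l' < (size (s j')).+1)
   weight s * capacity j * (gam j (size (s' j)).+1 l * del j' (size (s j')).+1 l') * (A l l')%:R).
  apply: eq_bigr => l _; rewrite /A; case: eqP => [sjl|_]/=; last first.
    by rewrite big1// => l' _; rewrite mulr0.
  by rewrite big_distrr/=; apply: eq_bigr => l' _; rewrite !mulrA.
rewrite exchange_big/=; apply: eq_bigr => l' _; case: eqP => [sjl'|NE]; last first.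
  rewrite big1// => l _; rewrite /A; case: eqP => [sjl|_]/=; last by rewrite mulr0.
  case: eqP => [E|_]; last by rewrite mulr0.
  by case: NE; have [] := mv s s' j j' l l' jj' (leq_ord l') sjl E.
rewrite big_distrr/=; apply: eq_bigr => l _.
rewrite /pt /A; case: (_ =P s) => [E'|NE']; last first.
  rewrite !mulr0; case: eqP => [sjl|_]/=; last by rewrite mulr0.
  case: eqP => [E|_]; last by rewrite mulr0.
  by case: NE'; have [] := mv s s' j j' l l' jj' (leq_ord l') sjl E.
have [sjl E er] := mv s' s j' j l' l j'j (leq_ord l) sjl' E'.
rewrite sjl E !eqxx/= !mulr1.
have -> : weight s * capacity j = weight s' * capacity j'.
  have := weight_insert l (remove_at j l s) ji.
  have := weight_insert l' (remove_at j' l' s') j'i.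
  by rewrite (insert_remove sjl) (insert_remove sjl') er => -> ->.
by ring.
Qed.

End Flows.

(** * Balance with the time-reversed network *)

Section Balance.
Variables (R : realType) (N : network R).
Implicit Types (i : route N) (j : queue N).

Definition at_position (f : forall j n, 'I_n -> R) j n l : R :=
  if insub l is Some k then f j n k else 0.

Lemma at_positionE (f : forall j n, 'I_n -> R) j n (l : 'I_n) :
  at_position f j n l = f j n l.
Proof. by rewrite /at_position valK. Qed.

Lemma at_position_ge0 (f : forall j n, 'I_n -> R) j n l :
  (forall j n (l : 'I_n), 0 <= f j n l) -> 0 <= at_position f j n l.
Proof. by move=> f0; rewrite /at_position; case: insub => [k|//]; exact: f0. Qed.

Definition last_queue i := last (first_queue i) (next_queues i).

Lemma onth_ltn (T : eqType) (x0 : T) r k : (k < size r)%N ->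
  onth r k = Some (nth x0 r k).
Proof. by elim: r k => [|y r IHr] [|k]//= /IHr. Qed.

Lemma next_queue_nth i k : (k <= size (next_queues i))%N ->
  next_queue i (nth (first_queue i) (route_path i) k) = onth (route_path i) k.+1.
Proof. by move=> ki; rewrite /next_queue index_uniq// path_uniq. Qed.

Lemma next_queue_notin i j : j \notin route_path i -> next_queue i j = None.
Proof. by move=> ji; rewrite /next_queue onth_default// (memNindex ji). Qed.

Lemma next_queue_index i j j' : next_queue i j = Some j' ->
  [/\ j \in route_path i, j' \in route_path i
    & index j' (route_path i) = (index j (route_path i)).+1].
Proof.
move=> nj; have [jin|/next_queue_notin] := boolP (j \in route_path i); last by rewrite nj.
have lt := onth_size nj; have <- := @onth_nth _ (first_queue i) _ _ _ nj.
by split; rewrite ?mem_nth// index_uniq// path_uniq.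
Qed.

Lemma sum_path (f : queue N -> R) i :
  \sum_(j in route_path i) f j =
  \sum_(k < (size (next_queues i)).+1) f (nth (first_queue i) (route_path i) k).
Proof.
rewrite -big_uniq/=; last exact: path_uniq.
by rewrite (big_nth (first_queue i)) big_mkord.
Qed.

Lemma sum_steps (f : queue N -> queue N -> R) i :
  \sum_j \sum_(j' | next_queue i j == Some j') f j j' =
  \sum_(k < size (next_queues i))
    f (nth (first_queue i) (route_path i) k) (nth (first_queue i) (route_path i) k.+1).
Proof.
pose h j := if next_queue i j is Some j' then f j j' else 0.
transitivity (\sum_j h j).
  apply: eq_bigr => j _; rewrite /h; case: next_queue => [j'|]; last by rewrite big1.
  by rewrite -[RHS](big_pred1_eq +%R j' (f j)); apply: eq_bigl => x; rewrite eq_sym.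
rewrite (bigID (mem (route_path i)))/= [X in _ + X]big1 ?addr0; last first.
  by move=> j /next_queue_notin; rewrite /h => ->.
rewrite sum_path big_ord_recr/= [X in _ + X](_ : _ = 0) ?addr0; last first.
  by rewrite /h next_queue_nth// onth_default.
apply: eq_bigr => k _; rewrite /h next_queue_nth ?(ltnW (ltn_ord k))//.
by rewrite /= (onth_ltn (first_queue i)).
Qed.

(** Each queue of a route except the first is entered by exactly one step; likewise, in
    [sum_path_last], each except the last is left by exactly one. This lets exits and transfers
    combine into all departures, backwards and forwards respectively. *)
Lemma sum_path_first (f : queue N -> R) i :
  \sum_(j in route_path i) f j =
  f (first_queue i) + \sum_j \sum_(j' | next_queue i j == Some j') f j'.
Proof. by rewrite (sum_steps (fun _ j' => f j')) sum_path big_ord_recl. Qed.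

Lemma last_queueE i :
  nth (first_queue i) (route_path i) (size (next_queues i)) = last_queue i.
Proof. by rewrite /last_queue -nth_last /route_path; case: (next_queues i). Qed.

Lemma sum_path_last (f : queue N -> R) i :
  \sum_(j in route_path i) f j =
  f (last_queue i) + \sum_j \sum_(j' | next_queue i j == Some j') f j.
Proof.
by rewrite (sum_steps (fun j _ => f j)) sum_path big_ord_recr/= addrC -last_queueE.
Qed.

Lemma last_in_path i : last_queue i \in route_path i.
Proof. exact: mem_last. Qed.

Lemma next_queue_None i j : j \in route_path i ->
  (next_queue i j == None) = (j == last_queue i).
Proof.
move=> ji; have x0 := first_queue i.
have -> : (next_queue i j == None) = (size (next_queues i) <= index j (route_path i))%N.
  rewrite /next_queue; case: leqP => [le|lt]; first by rewrite onth_default.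
  by rewrite (onth_ltn x0).
have lt : (index j (route_path i) <= size (next_queues i))%N.
  by rewrite -ltnS -[X in (_ < X)%N]/(size (route_path i)) index_mem.
apply/idP/eqP => [ge|->].
  by rewrite -last_queueE -[LHS](nth_index (first_queue i) ji); congr nth; apply/eqP; rewrite eqn_leq lt.
by rewrite -last_queueE index_uniq// path_uniq.
Qed.

Variable g : route N -> nat -> R.
Hypothesis g_gt0 : forall i k, 0 < g i k.

Let gam := at_position (@service R N).
Let del := at_position (@insertion R N).

(** Regroups the events by route, where reversal acts term by term. Validity is essential:
    [next_queue] is [None] off the route as well, and only in a valid configuration does [None] mean
    the last queue. *)
Lemma event_sumE (s : config N) F : valid s ->
  event_sum g s F =
  \sum_i (inject g del s i (first_queue i) F
          + depart gam s i (last_queue i) F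
          + \sum_j \sum_(j' | next_queue i j == Some j') transfer gam del s i j j' F).
Proof.
move=> vs; rewrite /event_sum.
under [RHS]eq_bigr do rewrite -addrA; rewrite big_split/=; congr (_ + _).
  by apply: eq_bigr => i _; apply: eq_bigr => l _; rewrite /del at_positionE.
pose M i j (l : nat) := if next_queue i j is Some j' then
    \sum_(l' < (size (s j')).+1) capacity j * gam j (size (s j)) l
       * del j' (size (s j')).+1 l' * F (insert_at i j' l' (remove_at j l s))
  else capacity j * gam j (size (s j)) l * F (remove_at j l s).
transitivity (\sum_j \sum_(l < size (s j)) \sum_(i | onth (s j) l == Some i) M i j l).
  apply: eq_bigr => j _; apply: eq_bigr => l _ /=.
  have sjl : onth (s j) l = Some (tnth (in_tuple (s j)) l).
    rewrite (onth_ltn (tnth (in_tuple (s j)) l))//.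
    by congr Some; exact/esym/tnth_nth.
  rewrite sjl (big_pred1 (tnth (in_tuple (s j)) l)) => [|i]; last by rewrite eq_sym.
  rewrite /M; case: next_queue => [j'|]; last by rewrite /gam at_positionE.
  by apply: eq_bigr => l' _; rewrite /gam /del !at_positionE.
transitivity (\sum_i \sum_j \sum_(l < size (s j) | onth (s j) l == Some i) M i j l).
  rewrite [RHS]exchange_big/=; apply: eq_bigr => j _.
  under eq_bigr do rewrite big_mkcond; under [RHS]eq_bigr do rewrite big_mkcond.
  by rewrite exchange_big.
apply: eq_bigr => i _.
transitivity (\sum_j (\sum_(j' | next_queue i j == Some j') transfer gam del s i j j' F
    + if next_queue i j == None then depart gam s i j F else 0)).
  apply: eq_bigr => j _; rewrite /M; case: next_queue => [j'|]/=.
    by rewrite addr0 (big_pred1 j')// => x; rewrite eq_sym.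
  by rewrite [X in _ = X + _]big_pred0// add0r.
rewrite big_split/= addrC; congr (_ + _); rewrite -big_mkcond/=.
rewrite (bigD1 (last_queue i)) ?next_queue_None ?last_in_path//= big1 ?addr0//.
move=> j /andP[jN jl]; rewrite /depart big1// => l /eqP /(valid_onth vs) ji.
by move: jl; rewrite -next_queue_None// jN.
Qed.

(* Sums of transition events between valid configurations, seen as functionals. *)
Definition flow (Phi : (config N -> R) -> R) :=
  [/\ forall F, (forall z, 0 <= F z) -> 0 <= Phi F,
      forall F c, Phi (fun z => F z - c) = Phi F - c * Phi (fun=> 1)
    & (\esum_(s' in [set: state N]) (Phi (fun z => (z == val s')%:R))%:E =
       (Phi (fun=> 1))%:E)%E].

Lemma flow_pt (c : R) z : 0 <= c -> valid z -> flow (fun F => c * F z).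
Proof.
move=> c0 vz; split=> [F F0|F d|]; first by rewrite mulr_ge0.
  by rewrite mulr1 mulrBr [d * c]mulrC.
rewrite (esumID [set (Sub z vz : state N)])/=; last by move=> s _; rewrite lee_fin mulr_ge0.
rewrite setTI esum_set1/=; last by rewrite lee_fin mulr_ge0.
rewrite eqxx esum1 ?adde0// => s [_ /= nsz]; case: eqP => [E|]; last by rewrite mulr0.
by case: nsz; apply: val_inj.
Qed.

Lemma flow_sum (A : finType) (P : pred A) (Phi : A -> (config N -> R) -> R) :
  (forall a, P a -> flow (Phi a)) -> flow (fun F => \sum_(a | P a) Phi a F).
Proof.
move=> fPhi; split=> [F F0|F c|].
- by apply: sumr_ge0 => a /fPhi[+ _ _]; exact.
- by rewrite mulr_sumr -sumrB; apply: eq_bigr => a /fPhi[_ + _]; exact.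
- under eq_esum do rewrite -sumEFin.
  rewrite esum_sum; last first.
    by move=> s a _ /fPhi[ge0 _ _]; rewrite lee_fin; apply: ge0 => z.
  by rewrite -sumEFin; apply: eq_bigr => a /fPhi[].
Qed.

Lemma flowD Phi Psi : flow Phi -> flow Psi -> flow (fun F => Phi F + Psi F).
Proof.
move=> [p1 p2 p3] [q1 q2 q3]; split=> [F F0|F c|].
- by rewrite addr_ge0 ?p1 ?q1.
- by rewrite p2 q2; ring.
- under eq_esum do rewrite EFinD.
  by rewrite esumD ?p3 ?q3// => s _; rewrite lee_fin ?p1 ?q1.
Qed.

Section Kernels.
Variables kap lam : queue N -> nat -> nat -> R.
Hypothesis kap_ge0 : forall j n l, 0 <= kap j n l.
Hypothesis lam_ge0 : forall j n l, 0 <= lam j n l.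
Hypothesis lam_sum1 : forall j n, (0 < n)%N -> \sum_(l < n) lam j n l = 1.
Variable s : config N.
Hypothesis vs : valid s.

Lemma inject_flow i j : j \in route_path i -> flow (inject g lam s i j).
Proof.
move=> ji; apply: flow_sum => l _; apply: flow_pt; last by rewrite valid_insert.
by rewrite mulr_ge0// ltW.
Qed.

Lemma depart_flow i j : flow (depart kap s i j).
Proof.
apply: flow_sum => l /eqP sjl; apply: flow_pt; last exact: valid_remove sjl.
by rewrite mulr_ge0// ltW// capacity_gt0.
Qed.

Lemma transfer_flow i j j' : j' \in route_path i -> flow (transfer kap lam s i j j').
Proof.
move=> j'i; apply: flow_sum => l /eqP sjl; apply: flow_sum => l' _; apply: flow_pt.
  by rewrite !mulr_ge0// ltW// capacity_gt0.
by rewrite valid_insert//; exact: valid_remove sjl.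
Qed.

Lemma inject_total i j : inject g lam s i j (fun=> 1) = g i (in_flight s i).
Proof.
rewrite /inject; under eq_bigr do rewrite mulr1.
by rewrite -mulr_sumr lam_sum1// mulr1.
Qed.

Lemma transfer_total i j j' :
  transfer kap lam s i j j' (fun=> 1) = depart kap s i j (fun=> 1).
Proof.
apply: eq_bigr => l _; under eq_bigr do rewrite mulr1.
by rewrite -mulr_sumr lam_sum1.
Qed.

End Kernels.

Definition total_rate (s : config N) : R :=
  \sum_i g i (in_flight s i) + \sum_(j | s j != [::]) capacity j.

(** A non-empty queue works at its full capacity for every kernel that sums to 1. Hence exchanging
    service and insertion probabilities leaves the total rate unchanged. *)
Lemma depart_path_total (kap : queue N -> nat -> nat -> R) (s : config N) : valid s ->
  (forall j n, (0 < n)%N -> \sum_(l < n) kap j n l = 1) ->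
  \sum_i \sum_(j in route_path i) depart kap s i j (fun=> 1) =
  \sum_(j | s j != [::]) capacity j.
Proof.
move=> vs kap1; rewrite (exchange_big_dep xpredT)//= [RHS]big_mkcond/=.
apply: eq_bigr => j _; transitivity (\sum_i depart kap s i j (fun=> 1)).
  rewrite [LHS]big_mkcond/=; apply: eq_bigr => i _; case: ifPn => // ji.
  by rewrite /depart big1// => l /eqP/(valid_onth vs); rewrite (negPf ji).
rewrite /depart; under eq_bigr do rewrite big_mkcond.
rewrite exchange_big/=.
transitivity (\sum_(l < size (s j)) capacity j * kap j (size (s j)) l).
  apply: eq_bigr => l _; rewrite -big_mkcond/=.
  rewrite (big_pred1 (tnth (in_tuple (s j)) l)) ?mulr1// => i.
  by rewrite (onth_ltn i)//= (tnth_nth i)/= eq_sym.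
rewrite -mulr_sumr; case: (s j) => [|x t]/=; first by rewrite big_ord0 mulr0.
by rewrite kap1// mulr1.
Qed.

Let gam_ge0 j n l : 0 <= gam j n l.
Proof. by apply: at_position_ge0 => *; exact: serve_ge0. Qed.

Let del_ge0 j n l : 0 <= del j n l.
Proof. by apply: at_position_ge0 => *; exact: insert_ge0. Qed.

Let gam_sum1 j n : (0 < n)%N -> \sum_(l < n) gam j n l = 1.
Proof. by move=> n0; under eq_bigr do rewrite /gam at_positionE; exact: serve_sum1. Qed.

Let del_sum1 j n : (0 < n)%N -> \sum_(l < n) del j n l = 1.
Proof. by move=> n0; under eq_bigr do rewrite /del at_positionE; exact: insert_sum1. Qed.

Let eq_flow Phi Psi : Phi =1 Psi -> flow Phi -> flow Psi.
Proof. by move=> /funext ->. Qed.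

Lemma event_sum_flow s : valid s -> flow (event_sum g s).
Proof.
move=> vs; apply: (eq_flow (fun F => esym (event_sumE F vs))).
apply: flow_sum => i _; apply: flowD.
  apply: flowD; last by apply: depart_flow.
  by apply: inject_flow => //; exact: mem_head.
by apply: flow_sum => j _; apply: flow_sum => j' /eqP/next_queue_index[_ ? _]; exact: transfer_flow.
Qed.

Lemma event_sum_total s : valid s -> event_sum g s (fun=> 1) = total_rate s.
Proof.
move=> vs; rewrite event_sumE// /total_rate -(depart_path_total vs gam_sum1) -big_split/=.
apply: eq_bigr => i _; rewrite sum_path_last inject_total// -addrA; congr (_ + (_ + _)).
by apply: eq_bigr => j _; apply: eq_bigr => j' _; rewrite transfer_total.
Qed.

(* The events of the time-reversed network: routes are run backwards, and the
   service and insertion probabilities trade places. *)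
Definition reversed_sum s F : R :=
  \sum_i (depart del s i (first_queue i) F + inject g gam s i (last_queue i) F
          + \sum_j \sum_(j' | next_queue i j == Some j') transfer del gam s i j' j F).

Lemma reversed_flow s : valid s -> flow (reversed_sum s).
Proof.
move=> vs; apply: flow_sum => i _; apply: flowD.
  apply: flowD; first by apply: depart_flow.
  by apply: inject_flow => //; exact: last_in_path.
by apply: flow_sum => j _; apply: flow_sum => j' /eqP/next_queue_index[? _ _]; exact: transfer_flow.
Qed.

Lemma reversed_total s : valid s -> reversed_sum s (fun=> 1) = total_rate s.
Proof.
move=> vs; rewrite /total_rate -(depart_path_total vs del_sum1) -big_split/=.
apply: eq_bigr => i _; rewrite sum_path_first inject_total// [X in X + _]addrC -addrA; congr (_ + (_ + _)).
by apply: eq_bigr => j _; apply: eq_bigr => j' _; rewrite transfer_total.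
Qed.

Variable W : route N -> nat -> R.
Hypothesis W_succ : forall i k, W i k.+1 = W i k * g i k.
Hypothesis W_gt0 : forall i k, 0 < W i k.

Lemma weight_reversed s s' : valid s ->
  weight W s * event_sum g s (fun z => (z == s')%:R) =
  weight W s' * reversed_sum s' (fun z => (z == s)%:R).
Proof.
move=> vs; rewrite event_sumE// /reversed_sum !mulr_sumr; apply: eq_bigr => i _.
rewrite !mulrDr; congr (_ + _ + _).
- by rewrite (inject_depart W_succ)// mem_head.
- by rewrite (inject_depart W_succ)// last_in_path.
- rewrite !mulr_sumr; apply: eq_bigr => j _; rewrite !mulr_sumr; apply: eq_bigr => j' /eqP nj.
  have [ji j'i E] := next_queue_index nj.
  apply: (transfer_rev W_succ) => //; apply: contraPneq E => ->.
  by apply/eqP; rewrite neq_ltn ltnSn.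
Qed.

Definition rate (s s' : state N) := event_sum g (val s) (fun z => (z == val s')%:R).

Lemma rate_ge0 s s' : 0 <= rate s s'.
Proof. by have [+ _ _] := event_sum_flow (valP s); apply => z. Qed.

Lemma rate_sum s : (\esum_(s' in setT) (rate s s')%:E = (total_rate (val s))%:E)%E.
Proof.
have vs : valid (val s) := valP s.
by have [_ _ E] := event_sum_flow vs; rewrite [LHS]E event_sum_total.
Qed.

Lemma weight_gt0 (s : config N) : 0 < weight W s.
Proof.
rewrite /weight mulr_gt0 ?prodr_gt0// => j _; rewrite prodr_gt0// => i _.
by rewrite invr_gt0 capacity_gt0.
Qed.

(** Summing [weight_reversed] over [s] turns the inflow into [s'] into the outflow of the reversed
    network from [s']. *)
Lemma weight_invariant : invariant_measure rate (fun s => total_rate (val s))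
  (fun s => weight W (val s)).
Proof.
split=> [s|s']; first exact/ltW/weight_gt0.
have vs' : valid (val s') := valP s'; have [rev_ge0 _ revE] := reversed_flow vs'.
transitivity (\esum_(s in [set: state N]) ((weight W (val s'))%:E *
    (reversed_sum (val s') (fun z => (z == val s)%:R))%:E))%E.
  apply: eq_esum => s _; have vs : valid (val s) := valP s.
  by rewrite -EFinM -weight_reversed.
rewrite esumZl; first by rewrite revE reversed_total.
- exact/ltW/weight_gt0.
- by move=> s; rewrite lee_fin; apply: rev_ge0.
Qed.

Lemma empty_valid : valid ([ffun=> [::]] : config N).
Proof. by apply/forallP => j; rewrite ffunE. Qed.

Definition empty_state : state N := Sub _ empty_valid.

(** The number of service completions that would empty the network without further injections; a
    packet in its last queue counts for 1. *)
Definition remaining_hops (s : config N) : nat :=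
  (\sum_j \sum_(x <- s j) (size (route_path x) - index j (route_path x)))%N.

Lemma sumr_gt0_term (I : finType) (F : I -> R) k :
  (forall a, 0 <= F a) -> 0 < F k -> 0 < \sum_a F a.
Proof. by move=> F0 Fk; rewrite (bigD1 k)//= ltr_wpDr// sumr_ge0. Qed.

Lemma sum1_gt0_term n (F : 'I_n -> R) : (forall l, 0 <= F l) -> \sum_l F l = 1 ->
  exists l, 0 < F l.
Proof.
move=> F0 F1; apply: contrapT => nF.
suff : \sum_l F l = 0 by rewrite F1; apply/eqP; rewrite oner_eq0.
apply: big1 => l _; apply/eqP; rewrite eq_le F0 andbT leNgt; apply/negP => Fl.
by apply: nF; exists l.
Qed.

(** Service proportions sum to 1, so a non-empty queue has a position served at positive rate;
    likewise the next queue has a position of positive insertion probability. That event moves one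
    packet one hop on. *)
Lemma descent (s : state N) : s != empty_state ->
  exists2 s' : state N, 0 < rate s s'
    & (remaining_hops (val s') < remaining_hops (val s))%N.
Proof.
move=> s_ne; have [j sj] : exists j, (val s) j != [::].
  apply/existsP; apply: contraNT s_ne => /existsPn sE.
  by apply/eqP/val_inj/ffunP => j; rewrite ffunE; apply/eqP; move: (sE j); rewrite negbK.
move: s_ne sj => _; case: s => s vs /= sj.
have [|l gl] := @sum1_gt0_term (size (s j)) (@service R N j _) (@serve_ge0 R N j _).
  by rewrite serve_sum1// lt0n size_eq0.
set i := tnth (in_tuple (s j)) l.
have sjl : onth (s j) l = Some i.
  by rewrite (onth_ltn i)//; congr Some; exact/esym/tnth_nth.
have ji := valid_onth vs sjl.
have rkE := big_remove_at addn (fun j x => size (route_path x) - index j (route_path x))%N sjl.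
have [z vz [zgt0 zrk]] : exists2 z, valid z & (0 < match next_queue i j with
      | Some j' =>
          \sum_(l' < (size (s j')).+1)
            capacity j * service j l * insertion j' l'
              * (insert_at i j' l' (remove_at j l s) == z)%:R
      | None => capacity j * service j l * (remove_at j l s == z)%:R
      end) /\ (remaining_hops z < remaining_hops s)%N.
  case nj: (next_queue i j) => [j'|]; last first.
    exists (remove_at j l s); first exact: valid_remove sjl.
    split; first by rewrite eqxx mulr1 mulr_gt0 ?capacity_gt0.
    by rewrite /remaining_hops [X in (_ < X)%N]rkE -[X in (X < _)%N]add0n ltn_add2r subn_gt0 index_mem.
  have [_ j'i ij'] := next_queue_index nj.
  have [l' dl'] := @sum1_gt0_term (size (s j')).+1 (@insertion R N j' _) (@insert_ge0 R N j' _)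
    (@insert_sum1 R N j' (size (s j')).+1 isT).
  exists (insert_at i j' l' (remove_at j l s)).
    by rewrite valid_insert//; exact: valid_remove sjl.
  split.
    apply: (@sumr_gt0_term _ _ l') => [k|].
      by rewrite !mulr_ge0// ?serve_ge0 ?insert_ge0// ltW// capacity_gt0.
    by rewrite eqxx mulr1 !mulr_gt0// capacity_gt0.
  rewrite /remaining_hops [X in (_ < X)%N]rkE (big_insert_at addn) ltn_add2r.
  by rewrite ij' ltn_sub2l// index_mem.
exists (Sub z vz : state N) => //; rewrite /rate /event_sum/=.
rewrite ltr_wpDl//.
  apply: sumr_ge0 => i' _; apply: sumr_ge0 => l' _.
  by rewrite !mulr_ge0// ?insert_ge0// ltW.
have term_ge0 j' (l' : 'I_(size (s j'))) : 0 <= match next_queue (tnth (in_tuple (s j')) l') j' with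
      | Some k =>
          \sum_(l2 < (size (s k)).+1)
            capacity j' * service j' l' * insertion k l2
              * (insert_at (tnth (in_tuple (s j')) l') k l2 (remove_at j' l' s) == z)%:R
      | None => capacity j' * service j' l' * (remove_at j' l' s == z)%:R
      end.
  have c0 := ltW (capacity_gt0 j').
  case: next_queue => [k|]; last by rewrite !mulr_ge0// serve_ge0.
  by apply: sumr_ge0 => l2 _; rewrite !mulr_ge0// ?serve_ge0 ?insert_ge0.
apply: (@sumr_gt0_term _ _ j) => [j'|]; first by apply: sumr_ge0 => l' _; exact: term_ge0.
exact: (@sumr_gt0_term _ _ l).
Qed.

(** Induction on the remaining hops: after a descent to [s'] with [nu s' = 0], excessiveness bounds
    the single inflow term [nu s * rate s s'] by 0. *)
Lemma empty_reached nu : excessive rate (fun s => total_rate (val s)) nu ->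
  nu empty_state = 0 -> forall s, nu s = 0.
Proof.
move=> [nu0 nue] nuo s; have [n] := ubnP (remaining_hops (val s)).
elim: n s => // n IHn s; rewrite ltnS => sn.
have [->//|/descent[s' ss' rk]] := eqVneq s empty_state.
have ns' : nu s' = 0 by apply: IHn; exact: leq_trans rk sn.
have := nue s'; rewrite ns' mul0r => le0.
have : ((nu s * rate s s')%:E <= 0)%E.
  apply: le_trans le0; have := @sum_le_esum R (state N) setT (fun s => (nu s * rate s s')%:E) [:: s].
  by rewrite big_seq1; apply.
rewrite lee_fin pmulr_lle0// => ns; apply/eqP.
by rewrite eq_le ns nu0.
Qed.

End Balance.

(** * Identification of the stationary law *)

Section Stationary.
Variables (R : realType) (N : network R) (g W : route N -> nat -> R).
Hypothesis g_gt0 : forall i k, 0 < g i k.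
Hypothesis W_succ : forall i k, W i k.+1 = W i k * g i k.
Hypothesis W_gt0 : forall i k, 0 < W i k.
Variables (P : R -> state N -> state N -> R) (p : state N -> R).
Hypothesis chainP : is_network_chain g P.
Hypothesis statp : is_stationary P p.

Lemma generatorE s s' :
  generator g s s' = rate g s s' - (s == s')%:R * total_rate g (val s).
Proof.
have vs : valid (val s) := valP s.
by have [_ + _] := event_sum_flow g_gt0 vs; rewrite /generator => ->; rewrite event_sum_total.
Qed.

(* [p P_h = p] bounds finite sums of [p (P_h - 1) / h]; let [h -> 0]. *)
Lemma stationary_excessive :
  excessive (rate g) (fun s => total_rate g (val s)) p.
Proof.
have [[ptf _ _] gen] := chainP; have [[p0 _] pinv] := statp.
split=> // s'.
have fin_le (r : seq (state N)) : uniq r -> s' \in r ->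
    \sum_(s <- r) p s * generator g s s' <= 0.
  move=> ur s'r.
  have cv : \sum_(s <- r) p s * ((P h s s' - (s == s')%:R) / h) @[h --> 0^'+]
      --> \sum_(s <- r) p s * generator g s s'.
    by apply: cvg_big => [|s _]; [exact: add_continuous|apply: cvgMr; exact: gen].
  rewrite -(cvg_lim _ cv)//; apply: limr_le; first by apply/cvg_ex; eexists; exact: cv.
  near=> h; have h0 : 0 < h by near: h; exact: nbhs_right_gt.
  under eq_bigr do rewrite mulrA.
  rewrite -mulr_suml pmulr_lle0 ?invr_gt0//.
  under eq_bigr do rewrite mulrBr.
  rewrite sumrB subr_le0.
  have -> : \sum_(s <- r) p s * (s == s')%:R = p s'.
    rewrite (bigD1_seq s')//= eqxx mulr1 big1 ?addr0// => s /negPf ->.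
    by rewrite mulr0.
  rewrite -lee_fin -(pinv h s' (ltW h0)) -sumEFin.
  exact: (@sum_le_esum R (state N) setT (fun s => (p s * P h s s')%:E)).
apply: esum_le => r ur _; rewrite sumEFin lee_fin.
(* The outflow term of the generator sits at [s'], so the finite sum must contain this state; adding
   it can only increase the inflow to be bounded. *)
pose r' := if s' \in r then r else s' :: r.
have ur' : uniq r' by rewrite /r'; case: ifPn => //= ->.
have s'r' : s' \in r' by rewrite /r'; case: ifPn => // _; exact: mem_head.
apply: (@le_trans _ _ (\sum_(s <- r') p s * rate g s s')).
  rewrite /r'; case: ifPn => // _; rewrite big_cons lerDr mulr_ge0//.
  exact: rate_ge0.
have := fin_le _ ur' s'r'; under eq_bigr do rewrite generatorE mulrBr.
rewrite sumrB subr_le0 => /le_trans; apply.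
rewrite (bigD1_seq s')//= eqxx mul1r big1 ?addr0// => s /negPf ->.
by rewrite mul0r mulr0.
Unshelve. all: by end_near. Qed.

Lemma stationary_weight (L : route N -> R) : (forall i k, g i k <= L i) ->
  exists2 a : R, 0 < a & forall s, p s = a * weight W (val s).
Proof.
move=> gL; have [[_ p1] _] := statp.
pose M := \sum_i L i + \sum_j @capacity R N j.
have qM (s : state N) : total_rate g (val s) <= M.
  rewrite lerD ?ler_sum// [leRHS](bigID (fun j => val s j != [::]))/= lerDl.
  by rewrite sumr_ge0// => j _; rewrite ltW// capacity_gt0.
exact: (@stationary_unique R (state N) (rate g) (fun s => total_rate g (val s))
  (rate_ge0 g_gt0) (rate_sum g_gt0) (empty_state N) (empty_reached g_gt0) M p
  (fun s => weight W (val s)) qM stationary_excessive p1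
  (weight_invariant g_gt0 W_succ W_gt0) (fun s => weight_gt0 W_gt0 (val s))).
Qed.

End Stationary.

(** * Weights of states in terms of counts *)

Section Counts.
Variables (R : realType) (N : network R).
Implicit Types (s : state N) (i : route N) (j : queue N).

Lemma packets_notin s j i : j \notin route_path i -> packets (val s) j i = 0%N.
Proof.
move=> ji; apply/count_memPn; apply: contra ji => isj.
by have /forallP/(_ j)/allP/(_ _ isj) := valP s.
Qed.

Lemma sum_incidence (f : queue N -> route N -> R) :
  (forall j i, j \notin route_path i -> f j i = 0) ->
  \sum_j \sum_i f j i = \sum_(k : incidence N) f (val k).1 (val k).2.
Proof.
move=> f0; rewrite pair_big/= (bigID (fun p => p.1 \in route_path p.2))/=.
rewrite [X in _ + X]big1 ?addr0; last by move=> [j i] /= /f0.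
rewrite (reindex_omap (fun k : incidence N => val k) insub); last first.
  by move=> p Pp; rewrite insubT.
by apply: eq_bigl => k; rewrite valK eqxx andbT; exact: (valP k).
Qed.

Lemma sum_word (T : finType) (f : T -> R) (w : seq T) :
  \sum_(x <- w) f x = \sum_x (count_mem x w)%:R * f x.
Proof.
elim: w => [|y w IHw]; first by rewrite big_nil big1// => x _; rewrite mul0r.
rewrite big_cons IHw; under [RHS]eq_bigr do rewrite /= natrD mulrDl.
rewrite big_split/=; congr (_ + _); rewrite (bigD1 y)//= eqxx mul1r big1 ?addr0//.
by move=> x; rewrite eq_sym => /negPf ->; rewrite mul0r.
Qed.

Lemma sum_state_incidence s (f : queue N -> route N -> R) :
  \sum_j \sum_(x <- val s j) f j x =
  \sum_(k : incidence N) (packets (val s) (val k).1 (val k).2)%:R * f (val k).1 (val k).2.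
Proof.
rewrite -(@sum_incidence (fun j i => (packets (val s) j i)%:R * f j i)) => [|j i ji].
  by apply: eq_bigr => j _; exact: sum_word.
by rewrite packets_notin// mul0r.
Qed.

Lemma sum_queue_total (m : vec N) (f : queue N -> R) :
  \sum_(k : incidence N) m k * f (val k).1 = \sum_j queue_total m j * f j.
Proof.
rewrite (partition_big (fun k : incidence N => (val k).1) xpredT)//=.
by apply: eq_bigr => j _; rewrite mulr_suml; apply: eq_bigr => k /eqP ->.
Qed.

Lemma queue_total_scaled c s j :
  queue_total (scaled_counts c s) j = (size (val s j))%:R / c%:R.
Proof.
rewrite /queue_total /scaled_counts -mulr_suml; congr (_ / _).
rewrite -[in RHS]sum_count natr_sum.
transitivity (\sum_j' \sum_i if j' == j then (packets (val s) j' i)%:R else 0 : R).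
  rewrite sum_incidence; first by rewrite big_mkcond.
  by move=> j' i j'i; case: ifP => // _; rewrite packets_notin.
rewrite (bigD1 j)//= eqxx [X in _ + X]big1 ?addr0// => j' /negPf j'j.
by rewrite big1// => i _; rewrite j'j.
Qed.

Lemma window_total_scaled c s i :
  window_total (scaled_counts c s) i = (in_flight (val s) i)%:R / c%:R.
Proof.
rewrite /window_total /scaled_counts -mulr_suml; congr (_ / _).
rewrite /in_flight natr_sum [RHS]big_mkcond/=.
transitivity (\sum_j \sum_i' if i' == i then (packets (val s) j i')%:R else 0 : R).
  rewrite sum_incidence; first by rewrite big_mkcond.
  by move=> j' i' j'i; case: ifP => // _; rewrite packets_notin.
apply: eq_bigr => j _; rewrite (bigD1 i)//= eqxx big1 ?addr0; last by move=> i' /negPf ->.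
by case: ifPn => // ji; rewrite packets_notin.
Qed.

Definition vec_total (m : vec N) : R := \sum_k m k.

Lemma vec_total_queue (m : vec N) : vec_total m = \sum_j queue_total m j.
Proof. by rewrite /vec_total (partition_big (fun k : incidence N => (val k).1) xpredT). Qed.

Lemma vec_total_window (m : vec N) : vec_total m = \sum_i window_total m i.
Proof. by rewrite /vec_total (partition_big (fun k : incidence N => (val k).2) xpredT). Qed.

(* The part of [beta] that does not depend on the windows, with logarithms
   separated so that it is visibly continuous. *)
Definition queue_cost (m : vec N) : R :=
  \sum_(k : incidence N) m k * ln (capacity (val k).1)
  + \sum_k m k * ln (m k) - \sum_j queue_total m j * ln (queue_total m j).

Lemma queue_total_ge (m : vec N) k : orthant m -> m k <= queue_total m (val k).1.
Proof.
by move=> m0; rewrite /queue_total (bigD1 k)//= lerDl sumr_ge0// => k' _; exact: m0.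
Qed.

Lemma betaE (G : route N -> R -> \bar R) (m : vec N) : orthant m ->
  beta G m = ((queue_cost m)%:E - \sum_i G i (window_total m i))%E.
Proof.
move=> m0; rewrite /beta; congr (_ - _)%E; congr EFin.
rewrite /queue_cost -(sum_queue_total m (fun j => ln (queue_total m j))).
rewrite -big_split -sumrB big_mkcond/=; apply: eq_bigr => k _.
case: ifPn => [mk|]; last first.
  by rewrite -leNgt => mk; rewrite (le_anti (introT andP (conj mk (m0 k)))) !mul0r addr0 subr0.
have q0 : 0 < queue_total m (val k).1 := lt_le_trans mk (queue_total_ge k m0).
have C0 := capacity_gt0 (val k).1.
rewrite ln_div ?posrE ?mulr_gt0// lnM ?posrE//.
by ring.
Qed.

Definition log_likelihood s : R := \sum_j \sum_(x <- val s j)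
  ln ((packets (val s) j x)%:R / (size (val s j))%:R).

Lemma empirical_log s : \prod_j empirical R (val s j) = expR (log_likelihood s).
Proof.
rewrite /log_likelihood expR_sum; apply: eq_bigr => j _.
rewrite expR_sum; apply: eq_big_seq => x xs; rewrite lnK// posrE divr_gt0// ltr0n.
  by rewrite -has_count has_pred1.
by case: (val s j) xs.
Qed.

(** The ratios of counts to queue lengths do not see the factor [1 / c], so [c * queue_cost] is the
    log-likelihood plus the capacity terms. Letters that do not occur fall under [0 * ln 0 = 0]. *)
Lemma queue_cost_scaled c s : (0 < c)%N ->
  log_likelihood s - c%:R * queue_cost (scaled_counts c s) =
  - \sum_j \sum_(x <- val s j) ln (capacity j).
Proof.
move=> c0; have c1 : c%:R != 0 :> R by rewrite pnatr_eq0 -lt0n.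
rewrite /log_likelihood !sum_state_incidence /queue_cost.
rewrite -(sum_queue_total _ (fun j => ln (queue_total (scaled_counts c s) j))).
rewrite mulrBr mulrDr !mulr_sumr -big_split -!sumrB -sumrN/=; apply: eq_bigr => k _.
rewrite queue_total_scaled /scaled_counts; set a := packets _ _ _; set b := size _.
set C := ln (capacity _); have ab : (a <= b)%N by exact: count_size.
case: (posnP a) => [->|a0]; first by rewrite !mul0r !mulr0; lra.
have b0 : (0 < b)%N := leq_trans a0 ab.
rewrite !ln_div ?posrE ?ltr0n//.
by field.
Qed.

(** The entropy in the cost is compensated by the likelihoods, so the identity is exact;
    [sum_empirical] then controls the sum of the second factor over all states. *)
Lemma weight_scaled (G : route N -> R -> \bar R) (d : route N -> nat -> R) c s :
  (0 < c)%N ->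
  weight (fun i n => expR (scaled_window (G i) (d i) c n)) (val s) =
  expR (- c%:R * (queue_cost (scaled_counts c s)
     - \sum_i fine (G i (window_total (scaled_counts c s) i + d i c / c%:R))))
  * \prod_j empirical R (val s j).
Proof.
move=> c0; rewrite empirical_log -expRD /weight.
have -> : \prod_j \prod_(x <- val s j) (capacity j)^-1 =
    expR (- \sum_j \sum_(x <- val s j) ln (capacity j)).
  rewrite -sumrN expR_sum; apply: eq_bigr => j _.
  rewrite -sumrN expR_sum; apply: eq_bigr => x _.
  by rewrite expRN lnK// posrE capacity_gt0.
rewrite -expR_sum -expRD -(queue_cost_scaled s c0); congr expR.
set F := \sum_i fine _.
have -> : \sum_i scaled_window (G i) (d i) c (in_flight (val s) i) = c%:R * F.
  rewrite mulr_sumr; apply: eq_bigr => i _.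
  by rewrite /scaled_window /window_arg window_total_scaled.
by ring.
Qed.

End Counts.

(** * Sums over states as products over queues *)

Section StateSums.
Variables (R : realType) (N : network R).

(** A state is a family of words, one for each queue. On a finite set of states the lengths are
    bounded by some [L], and the sum over all families of words of length at most [L] factorizes;
    the bounds [S j] must not depend on [L]. *)
Lemma esum_state_le (f : queue N -> seq (route N) -> R) (S : queue N -> R) :
  (forall j w, 0 <= f j w) ->
  (forall j L, \sum_(w : L.-bseq (route N)) f j w <= S j) ->
  (\esum_(s in [set: state N]) (\prod_j f j (val s j))%:E <= (\prod_j S j)%:E)%E.
Proof.
move=> f0 fS; apply: esum_le => r ur _; rewrite sumEFin lee_fin.
pose L := (\max_(s <- r) \max_j size (val s j))%N.
pose emb (s : state N) : {ffun queue N -> L.-bseq (route N)} := [ffun j => insub_bseq L (val s j)].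
have embE s j : s \in r -> emb s j = val s j :> seq _.
  move=> sr; rewrite ffunE insubdK// unfold_in/=.
  by apply: leq_trans (leq_bigmax_seq _ sr isT); exact: leq_bigmax.
apply: (@le_trans _ _ (\sum_(t <- map emb r) \prod_j f j (t j))).
  rewrite big_map le_eqVlt; apply/orP; left; apply/eqP.
  by apply: eq_big_seq => s sr; apply: eq_bigr => j _; rewrite embE.
rewrite big_uniq; last first.
  rewrite map_inj_in_uniq// => s s' sr s'r ss'; apply/val_inj/ffunP => j.
  by rewrite -!embE// ss'.
apply: (@le_trans _ _ (\sum_(t : {ffun queue N -> L.-bseq (route N)}) \prod_j f j (t j))).
  rewrite [leRHS](bigID (mem (map emb r)))/= lerDl sumr_ge0// => t _.
  by apply: prodr_ge0.
rewrite -(bigA_distr_bigA (fun j (w : L.-bseq (route N)) => f j w)).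
by apply: ler_prod => j _; rewrite fS sumr_ge0.
Qed.

Variable n : queue N -> route N -> nat.
Hypothesis n_path : forall j i, j \notin route_path i -> n j i = 0%N.

Definition sample_word j := flatten [seq nseq (n j i) i | i <- enum (route N)].

Lemma count_sample_word j i : count_mem i (sample_word j) = n j i.
Proof.
rewrite count_flatten sumnE big_map big_map big_enum/= (bigD1 i)//= count_nseq/= eqxx mul1n.
by rewrite big1 ?addn0// => i' /negPf ii'; rewrite count_nseq/= ii'.
Qed.

(** Independent rearrangements of [sample_word j] in every queue give distinct states with the
    counts [n], on all of which [v] has the value [v0]. *)
Lemma esum_state_ge (A : set (state N)) (v : state N -> R) (v0 : R) :
  (forall s, 0 <= v s) ->
  (forall s : state N, (forall j i, packets (val s) j i = n j i) -> A s /\ v s = v0) ->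
  ((v0 * \prod_j (size (permutations (sample_word j)))%:R)%:E <=
    \esum_(s in A) (v s)%:E)%E.
Proof.
move=> v_ge0 vA; pose L := (\max_j size (sample_word j))%N.
pose F j : pred (L.-bseq (route N)) := [pred w : L.-bseq (route N) | perm_eq w (sample_word j)].
have cF j : #|F j| = size (permutations (sample_word j)).
  rewrite cardE -(size_map val); apply/perm_size/uniq_perm.
  - by rewrite map_inj_uniq ?enum_uniq//; exact: val_inj.
  - exact: permutations_uniq.
  move=> w; rewrite mem_permutations; apply/mapP/idP => [[b]|pw].
    by rewrite mem_enum inE => pb ->.
  exists (insub_bseq L w); last by rewrite insubdK// unfold_in/= (perm_size pw) leq_bigmax.
  by rewrite mem_enum inE insubdK// unfold_in/= (perm_size pw) leq_bigmax.
pose conf (t : {ffun queue N -> L.-bseq (route N)}) : config N := [ffun j => val (t j)].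
have vconf t : t \in family F -> valid (conf t).
  move=> /familyP tF; apply/forallP => j; apply/allP => i; rewrite ffunE.
  move: (tF j); rewrite inE => /perm_mem ->; apply: contraTT => /n_path nji.
  by apply/count_memPn; rewrite count_sample_word.
pose st t : state N := insubd (empty_state N) (conf t).
have stE t : t \in family F -> val (st t) = conf t.
  by move=> /vconf vt; rewrite insubdK.
have stF t : t \in family F -> A (st t) /\ v (st t) = v0.
  move=> tF; apply: vA => j i; rewrite stE// /packets ffunE.
  move/familyP: tF => /(_ j); rewrite inE => /permP ->; exact: count_sample_word.
apply: le_trans (@sum_le_esum R (state N) A (fun s => (v s)%:E) (map st (enum (family F))) _ _).
- rewrite sumEFin lee_fin big_map big_enum/=.
  rewrite [leRHS](eq_bigr (fun=> v0)); last by move=> t tF; have [_ ->] := stF t tF.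
  rewrite sumr_const -[leRHS]mulr_natr le_eqVlt; apply/orP; left; apply/eqP.
  rewrite card_family -natr_prod; congr (_ * _%:R).
  rewrite foldrE big_map big_enum/=; apply: eq_bigr => j _; exact/esym/cF.
- rewrite map_inj_in_uniq ?enum_uniq// => t t'; rewrite !mem_enum => tF t'F ss.
  apply/ffunP => j; apply: val_inj; have := congr1 val ss; rewrite !stE// => /ffunP/(_ j).
  by rewrite !ffunE.
- by move=> s /mapP[t]; rewrite mem_enum => tF ->; have [] := stF t tF.
Qed.

End StateSums.

(** * The rate function *)

Section Window.
Variables (R : realType) (U : R -> R).
Let G := window_fun U.

Lemma window_le m lam : (G m <= (m * lam - U (expR lam))%:E)%E.
Proof.
rewrite /G /window_fun leeNl -EFinN opprB.
by apply: ereal_sup_ubound; exists lam.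
Qed.

Lemma window_lt m r : (G m < r%:E)%E -> exists lam, m * lam - U (expR lam) < r.
Proof.
rewrite /G /window_fun lteNl -EFinN => /ereal_sup_gt[_ [lam _ <-]].
by rewrite lte_fin => h; exists lam; rewrite -ltrN2 opprB.
Qed.

(* [window_fun U] is an infimum of affine functions. *)
Lemma window_concave x y t : 0 <= t <= 1 ->
  G x \is a fin_num -> G y \is a fin_num -> G (t * x + (1 - t) * y) \is a fin_num ->
  t * fine (G x) + (1 - t) * fine (G y) <= fine (G (t * x + (1 - t) * y)).
Proof.
move=> /andP[t0 t1] fx fy fz; rewrite leNgt; apply/negP => lt.
have := lt; rewrite -lte_fin (fineK fz) => /window_lt[lam].
apply/negP; rewrite -leNgt.
have := window_le x lam; have := window_le y lam.
rewrite -{1}(fineK fx) -{1}(fineK fy) !lee_fin => ly lx.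
have -> : (t * x + (1 - t) * y) * lam - U (expR lam) =
  t * (x * lam - U (expR lam)) + (1 - t) * (y * lam - U (expR lam)) by ring.
by rewrite lerD// ler_wpM2l// subr_ge0.
Qed.

(** Each window argument is the midpoint of its two neighbours, so by concavity the increments
    decrease in [k]. This is the source of the bounded jump rates. *)
Lemma injection_rate_le d c k : (0 < c)%N ->
  (forall k, G (window_arg d c k) \is a fin_num) ->
  injection_rate G d c k <= injection_rate G d c 0.
Proof.
move=> c0 fG; elim: k => // k; apply: le_trans; rewrite /injection_rate ler_expR.
rewrite /scaled_window -!mulrBr ler_pM2l ?ltr0n//.
have E : window_arg d c k.+1 = 2^-1 * window_arg d c k.+2 + (1 - 2^-1) * window_arg d c k.
  rewrite /window_arg -[k.+2%:R]natr1 -[k.+1%:R]natr1; field.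
  by rewrite pnatr_eq0 -lt0n.
have := @window_concave (window_arg d c k.+2) (window_arg d c k) 2^-1.
rewrite -E => /(_ _ (fG _) (fG _) (fG _)).
have h2 : 0 <= (2^-1 : R) <= 1 by rewrite invr_ge0 invf_le1// ler1n ltW//=.
by move=> /(_ h2); lra.
Qed.

Hypothesis regG : regular_window G.

(* At an interior point [G] is continuous; at 0 concavity bounds it from below
   by a chord. *)
Lemma window_lower (T : Type) (F : set_system T) (FF : Filter F) (y : T -> R) x e :
  0 <= x -> G x \is a fin_num -> y @ F --> x ->
  (\forall t \near F, 0 <= y t /\ G (y t) \is a fin_num) -> 0 < e ->
  \forall t \near F, fine (G x) - e <= fine (G (y t)).
Proof.
have [Gfin _ Gder _ _] := regG.
rewrite le_eqVlt => /predU1P[<-|x0] fx yx ynear e0.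
  have f1 : G 1 \is a fin_num by exact: Gfin.
  pose D := `|fine (G 0) - fine (G 1)| + 1.
  have D0 : 0 < D by rewrite ltr_pwDr.
  have eD : 0 < Num.min 1 (e / D) by rewrite lt_min ltr01 divr_gt0.
  near=> t.
  have [yt0 fyt] : 0 <= y t /\ G (y t) \is a fin_num by near: t.
  have : y t < Num.min 1 (e / D) by near: t; exact: (cvgr_lt 0).
  rewrite lt_min => /andP[yt1 yte].
  (* The chord over [[0, 1]] gives [G (y t) >= G 0 - y t * (G 0 - G 1)]; since [y t < e / D], the
     loss is at most [e]. *)
  have := @window_concave 1 0 (y t); rewrite mulr1 mulr0 addr0.
  rewrite yt0 (ltW yt1) => /(_ isT f1 fx fyt).
  have : y t * (fine (G 0) - fine (G 1)) <= e.
    apply: (@le_trans _ _ (y t * D)); last by rewrite -ler_pdivlMr// ltW.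
    by rewrite ler_wpM2l// (le_trans (ler_norm _))// lerDl.
  by lra.
have cG : {for x, continuous (fun m => fine (G m))}.
  by apply: differentiable_continuous; apply/derivable1_diffP; exact: Gder.
have cGy := cvg_comp _ _ yx cG.
near=> t; apply: ltW; near: t; apply: (cvgr_gt _ cGy).
by rewrite ltrBlDr ltrDl.
Unshelve. all: by end_near. Qed.

End Window.

(** * Continuity, coercivity and minimum of the costs *)

Section ContinuousArithmetic.
Variables (R : realType) (T : topologicalType) (f g : T -> R).
Hypotheses (fc : continuous f) (gc : continuous g).

Lemma continuous_const (z : R) : continuous (fun _ : T => z).
Proof. by move=> x; exact: cvg_cst. Qed.

Lemma continuous_add : continuous (fun x => f x + g x).
Proof. by move=> x; have H := cvgD (@fc x) (@gc x); exact: (H _). Qed.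

Lemma continuous_sub : continuous (fun x => f x - g x).
Proof. by move=> x; have H := cvgB (@fc x) (@gc x); exact: (H _). Qed.

Lemma continuous_mul : continuous (fun x => f x * g x).
Proof. by move=> x; have H := cvgM (@fc x) (@gc x); exact: (H _). Qed.

End ContinuousArithmetic.

Section Costs.
Variables (R : realType) (N : network R) (U : route N -> R -> R).
Implicit Types (m : vec N) (e lam : route N -> R).
Let G i := window_fun (U i).

Lemma continuous_coord k : continuous (fun m : vec N => m k).
Proof. exact: proj_continuous. Qed.

Lemma continuous_sum_vec (I : finType) (A : pred I) (f : I -> vec N -> R) :
  (forall i, continuous (f i)) -> continuous (fun m => \sum_(i | A i) f i m).
Proof.
move=> fc m; apply: (@cvg_big R I +%R 0 A _ (vec N) (nbhs m) (index_enum I) f (f^~ m)).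
  exact: add_continuous.
by move=> i _; exact: fc.
Qed.

Lemma continuous_queue_total j : continuous (fun m : vec N => queue_total m j).
Proof. by apply: continuous_sum_vec => k; exact: continuous_coord. Qed.

Lemma continuous_window_total i : continuous (fun m : vec N => window_total m i).
Proof. by apply: continuous_sum_vec => k; exact: continuous_coord. Qed.

Lemma continuous_queue_cost : continuous (@queue_cost R N).
Proof.
pose f1 k (m : vec N) := m k * ln (capacity (val k).1).
pose f2 (k : incidence N) (m : vec N) := m k * ln (m k).
pose f3 j (m : vec N) := queue_total m j * ln (queue_total m j).
have c1 : continuous (fun m => \sum_k f1 k m).
  apply: (@continuous_sum_vec _ predT f1) => k m.
  exact: (continuous_mul (@continuous_coord k) (@continuous_const _ _ _)).
have c2 : continuous (fun m => \sum_k f2 k m).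
  apply: (@continuous_sum_vec _ predT f2) => k m.
  exact: (cvg_comp _ _ (@continuous_coord k m) (@continuous_xln R (m k))).
have c3 : continuous (fun m => \sum_j f3 j m).
  apply: (@continuous_sum_vec _ predT f3) => j m.
  exact: (cvg_comp _ _ (@continuous_queue_total j m) (@continuous_xln R (queue_total m j))).
exact: (continuous_sub (continuous_add c1 c2) c3).
Qed.

Definition shifted_cost e m : R :=
  queue_cost m - \sum_i fine (G i (window_total m i + e i)).

(* [lam] picks one term in each of the suprema that define the windows. *)
Definition affine_cost lam e m : R :=
  queue_cost m + \sum_i (U i (expR (lam i)) - (window_total m i + e i) * lam i).

Lemma affine_cost_le lam e m :
  (forall i, G i (window_total m i + e i) \is a fin_num) ->
  affine_cost lam e m <= shifted_cost e m.
Proof.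
move=> fG; rewrite /affine_cost /shifted_cost lerD2l -sumrN ler_sum// => i _.
rewrite lerNr opprB -lee_fin fineK//.
exact: window_le.
Qed.

Lemma window_neq_pinfty i x : (G i x < +oo)%E.
Proof. exact: le_lt_trans (window_le (U i) x 0) (ltry _). Qed.

Lemma affine_cost_le_beta lam m : orthant m ->
  ((affine_cost lam (fun=> 0%R) m)%:E <= beta G m)%E.
Proof.
move=> m0; rewrite betaE// /affine_cost EFinD leeD2l// -[leLHS]oppeK leeN2.
rewrite -EFinN -sumrN -sumEFin; apply: lee_sum => i _.
by rewrite opprB addr0; exact: window_le.
Qed.

(** The supremum over slopes is approached route by route, so the gap between [a] and [beta G m] is
    first shared out by thresholds [r i] above the windows. If some window is [-oo], its threshold
    can be taken low enough to pay for all the others. *)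
Lemma beta_gt_affine m (a : R) : orthant m -> (a%:E < beta G m)%E ->
  exists lam, a < affine_cost lam (fun=> 0) m.
Proof.
move=> m0; rewrite betaE// => ltab.
have [r rG ra] : exists2 r : route N -> R,
    forall i, (G i (window_total m i) < (r i)%:E)%E & a < queue_cost m - \sum_i r i.
  have [finG|] := pselect (forall i, G i (window_total m i) \is a fin_num).
    have E i : G i (window_total m i) = (fine (G i (window_total m i)))%:E by rewrite fineK.
    move: ltab; under eq_bigr do rewrite E.
    rewrite sumEFin -EFinB lte_fin; set S := \sum_i _ => ltab.
    (* One share more than there are routes keeps the total slack strictly below the gap, even with
       no route. *)
    pose del := (queue_cost m - S - a) / #|route N|.+1%:R.
    have del0 : 0 < del by rewrite divr_gt0// subr_gt0.
    exists (fun i => fine (G i (window_total m i)) + del).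
      by move=> i; rewrite E lte_fin ltrDl.
    rewrite big_split/= -/S sumr_const.
    have : del *+ #|{: route N}| < queue_cost m - S - a.
      rewrite -mulr_natr /del mulrAC ltr_pdivrMr// ltr_pM2l ?subr_gt0//.
      by rewrite ltr_nat.
    by lra.
  move=> /existsNP[i0 nf].
  have Ni0 : G i0 (window_total m i0) = -oo%E.
    by move: nf (window_neq_pinfty i0 (window_total m i0)); case: (G i0 _).
  pose r0 i := fine (G i (window_total m i)) + 1.
  exists (fun i => if i == i0 then queue_cost m - \sum_(i | i != i0) r0 i - a - 1 else r0 i).
    move=> i; case: eqP => [->|_]; first by rewrite Ni0 ltNyr.
    rewrite /r0; move: (window_neq_pinfty i (window_total m i)).
    by case: (G i _) => [x|//|]//= _; rewrite ?lte_fin ?ltrDl ?ltNyr.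
  rewrite (bigD1 i0)//= eqxx.
  have -> : \sum_(i | i != i0) (if i == i0 then
      queue_cost m - \sum_(i | i != i0) r0 i - a - 1 else r0 i) = \sum_(i | i != i0) r0 i.
    by apply: eq_bigr => i /negPf ->.
  by lra.
have /choice[lam lamP] : forall i, exists l, window_total m i * l - U i (expR l) < r i.
  by move=> i; exact: window_lt (rG i).
exists lam; apply: (lt_le_trans ra); rewrite /affine_cost lerD2l -sumrN ler_sum// => i _.
by rewrite addr0 lerNl opprB ltW.
Qed.

(** For fixed [lam] the cost is continuous in [m] and affine in the shifts. The joint neighbourhood
    is the form that [compact_near_coveringP] asks for. *)
Lemma affine_cost_near lam m (a : R) (T : Type) (F : set_system T) (FF : Filter F)
    (e : route N -> T -> R) : a < affine_cost lam (fun=> 0) m ->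
  (forall i, e i @ F --> 0) ->
  \forall m' \near m & t \near F, a < affine_cost lam (fun i => e i t) m'.
Proof.
move=> am e0; pose b := (affine_cost lam (fun=> 0) m - a) / 2.
have b0 : 0 < b by rewrite divr_gt0// subr_gt0.
have cA : continuous (affine_cost lam (fun=> 0)).
  pose f i (m : vec N) := U i (expR (lam i)) - (window_total m i + 0) * lam i.
  have cf : continuous (fun m => \sum_i f i m).
    apply: (@continuous_sum_vec _ predT f) => i x.
    have cst (z : R) : continuous (fun _ : vec N => z) by exact: continuous_const.
    exact: (continuous_sub (cst _) (continuous_mul (continuous_add (@continuous_window_total i) (cst _)) (cst _))).
  exact: (continuous_add continuous_queue_cost cf).
have cE : (fun t => \sum_i e i t * lam i) @ F --> 0.
  have H := @cvg_big R _ +%R 0 predT _ T F (index_enum (route N))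
    (fun i t => e i t * lam i) (fun i => 0 * lam i) FF.
  have E : \sum_i 0 * lam i = 0 by rewrite big1// => i _; rewrite mul0r.
  rewrite -[X in _ --> X]E; apply: H => [|i _]; first exact: add_continuous.
  by apply: cvgMl; exact: e0.
near=> m' t.
have E : affine_cost lam (fun i => e i t) m' =
    affine_cost lam (fun=> 0) m' - \sum_i e i t * lam i.
  rewrite /affine_cost -[RHS]addrA; congr (_ + _); rewrite -sumrB.
  by apply: eq_bigr => i _; ring.
have h1 : affine_cost lam (fun=> 0) m - b < affine_cost lam (fun=> 0) m'.
  near: m'; apply: (cvgr_gt _ (cA m)); by rewrite ltrBlDr ltrDl.
have h2 : \sum_i e i t * lam i < b by near: t; exact: (cvgr_lt 0).
by rewrite E; move: h1 h2; rewrite /b; lra.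
Unshelve. all: by end_near. Qed.

Lemma vec_total_ge m k : orthant m -> m k <= vec_total m.
Proof.
by move=> m0; rewrite /vec_total (bigD1 k)//= lerDl sumr_ge0// => k' _; exact: m0.
Qed.

Lemma vec_total_ge0 m : orthant m -> 0 <= vec_total m.
Proof. by move=> m0; apply: sumr_ge0 => k _; exact: m0. Qed.

(** The entropy terms are at least linear: [x * ln (x / q) >= - q], because [ln (q / x) <= q / x].
    Each incidence thus costs at least [- (|ln C| + 1)] times the total. *)
Lemma queue_cost_ge : exists C : R, forall m, orthant m ->
  - C * vec_total m <= queue_cost m.
Proof.
exists (\sum_(k : incidence N) (`|ln (capacity (val k).1)| + 1)) => m m0.
rewrite /queue_cost -(sum_queue_total m (fun j => ln (queue_total m j))).
rewrite -big_split -sumrB/= -sumrN mulr_suml; apply: ler_sum => k _.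
have T0 := vec_total_ge0 m0; have mT := vec_total_ge k m0.
have mk0 : 0 <= m k := m0 k.
have h1 : - `|ln (capacity (val k).1)| * vec_total m <= m k * ln (capacity (val k).1).
  rewrite mulNr lerNl -mulrN (le_trans (ler_norm _))// normrM normrN mulrC.
  by rewrite ler_wpM2l// ger0_norm.
have qT : queue_total m (val k).1 <= vec_total m.
  rewrite vec_total_queue (bigD1 (val k).1)//= lerDl sumr_ge0// => j _.
  by apply: sumr_ge0 => k' _; exact: m0.
have h2 : - vec_total m <= m k * ln (m k) - m k * ln (queue_total m (val k).1).
  have [->|mk] := eqVneq (m k) 0; first by rewrite !mul0r subrr oppr_le0.
  have mk1 : 0 < m k by rewrite lt_neqAle eq_sym mk.
  have q0 : 0 < queue_total m (val k).1 := lt_le_trans mk1 (queue_total_ge k m0).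
  rewrite -mulrBr -opprB mulrN lerN2 -ln_div ?posrE//.
  apply: le_trans qT; rewrite -ler_pdivlMl// [leRHS]mulrC.
  by apply/ltW/ln_sublinear; rewrite divr_gt0.
by move: h1 h2; lra.
Qed.

(** Slope [- b] in every window adds [b] times the total, which beats the constant of
    [queue_cost_ge] and leaves slope 1. Nonnegative shifts only increase the cost, so the bound is
    uniform in them. *)
Lemma affine_cost_coercive : exists lam (B : R), forall m e, orthant m ->
  (forall i, 0 <= e i) -> vec_total m - B <= affine_cost lam e m.
Proof.
have [C CP] := queue_cost_ge; pose b := `|C| + 1.
exists (fun=> - b), (- \sum_i U i (expR (- b))) => m e m0 e0.
rewrite /affine_cost sumrB opprK.
have : \sum_i (window_total m i + e i) * - b <= - b * vec_total m.
  rewrite -mulr_suml mulrC ler_wnM2l ?oppr_le0 ?addr_ge0//.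
  by rewrite vec_total_window ler_sum// => i _; rewrite lerDl.
have := CP m m0; have := vec_total_ge0 m0.
have : C * vec_total m <= `|C| * vec_total m.
  by rewrite ler_wpM2r ?ler_norm// vec_total_ge0.
by rewrite /b; lra.
Qed.

Definition box (r : R) : set (vec N) := [set m | forall k, `[0, r]%classic (m k)].

Lemma box_compact r : compact (box r).
Proof. by apply: (@tychonoff _ (fun=> R) (fun=> `[0, r]%classic)) => k; exact: segment_compact. Qed.

Lemma box_orthant r m : box r m -> orthant m.
Proof. by move=> mr k; have := mr k; rewrite /= in_itv/= => /andP[]. Qed.

Lemma orthant_box r m : orthant m -> vec_total m <= r -> box r m.
Proof.
move=> m0 mr k; rewrite /= in_itv/= (m0 k)/=.
exact: le_trans (vec_total_ge k m0) mr.
Qed.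

Lemma beta_near m (a : R) : orthant m -> (a%:E < beta G m)%E ->
  \forall m' \near m, orthant m' -> (a%:E < beta G m')%E.
Proof.
move=> m0 /(beta_gt_affine m0)[lam am].
(* The shifts are constantly 0 here, so any index [n] far enough out witnesses the second component
   of the neighbourhood. *)
have [|[A B] [/= mA [n _ nB]] AB] := @affine_cost_near lam m a nat \oo _ (fun _ _ => 0) am.
  by move=> i; exact: cvg_cst.
apply: filterS mA => m' Am' m'0; apply: lt_le_trans (affine_cost_le_beta lam m'0).
by rewrite lte_fin; apply: (AB (m', n)); split=> //=; apply: nB => /=.
Qed.

Lemma beta_coercive : exists B : R, forall m, orthant m ->
  ((vec_total m - B)%:E <= beta G m)%E.
Proof.
have [lam [B BP]] := affine_cost_coercive; exists B => m m0.
by apply: le_trans (affine_cost_le_beta lam m0); rewrite lee_fin BP.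
Qed.

Lemma beta_sublevel_compact (a : R) :
  compact [set m : vec N | orthant m /\ (beta G m <= a%:E)%E].
Proof.
have [B BP] := beta_coercive.
apply: (@subclosed_compact _ _ (box (a + B))); last 2 first.
- exact: box_compact.
- move=> m [m0 ma]; apply: orthant_box => //.
  by have := le_trans (BP m m0) ma; rewrite lee_fin lerBlDr.
rewrite -[X in closed X]setCK; apply: open_closedC; rewrite openE => m /= nm.
have [m0|m0] := pselect (orthant m).
  have am : (a%:E < beta G m)%E by rewrite ltNge; apply/negP => le; apply: nm.
  by apply: filterS (beta_near m0 am) => m' h [/h + le]; rewrite ltNge le.
have [k /negP] : exists k, ~ 0 <= m k by apply/existsNP.
rewrite -ltNge => mk.
have : \forall m' \near m, m' k < 0 by apply: (cvgr_lt _ (@continuous_coord k m)).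
by apply: filterS => m' m'k [/(_ k) + _]; rewrite leNgt m'k.
Qed.

(** If the infimum [b] were not attained, [beta_near] and compactness of the box would give one
    level [t > b] below [beta] on the whole box. Outside it the total exceeds [b + 1 + B], and
    coercivity puts [beta] above [b + 1]. *)
Lemma beta_minimizer : (exists2 m, orthant m & (beta G m < +oo)%E) ->
  exists2 m, orthant m & beta G m = beta_min G /\ beta_min G \is a fin_num.
Proof.
move=> [m1 m1_0 m1_oo]; have [B BP] := beta_coercive.
have lbd : ((- B)%:E <= beta_min G)%E.
  apply: le_ereal_inf_tmp => _ [m m0 <-]; apply: le_trans (BP m m0).
  by rewrite lee_fin lerDr vec_total_ge0.
have ubd : (beta_min G <= beta G m1)%E by apply: ereal_inf_lbound; exists m1.
have fmin : beta_min G \is a fin_num.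
  rewrite fin_numE gt_eqF/= ?(lt_le_trans _ lbd) ?ltNyr//.
  by rewrite lt_eqF// (le_lt_trans ubd).
apply: contrapT => nex.
have gtmin m : orthant m -> (beta_min G < beta G m)%E.
  move=> m0; rewrite lt_neqAle; apply/andP; split; last by apply: ereal_inf_lbound; exists m.
  by apply/eqP => E; apply: nex; exists m.
pose b := fine (beta_min G); have bE : beta_min G = b%:E by rewrite fineK.
have /compact_near_coveringP/(_ R b^'+ (fun t m => orthant m -> (t%:E < beta G m)%E)) :
  compact (box (b + 1 + B)) := @box_compact _.
move=> /(_ _)[].
  move=> m /box_orthant m0.
  have [t bt tm] : exists2 t, b < t & (t%:E < beta G m)%E.
    have := gtmin m m0; rewrite bE; case: (beta G m) => [x||]//.
      by rewrite lte_fin => bx; exists ((b + x) / 2); rewrite ?lte_fin ?midf_lt.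
    by move=> _; exists (b + 1); rewrite ?ltry// ltrDl.
  near=> m' t'.
  have tt : t' <= t by near: t'; exact: nbhs_right_le.
  have m'P : orthant m' -> (t%:E < beta G m')%E by near: m'; exact: beta_near.
  by move=> /m'P; apply: le_lt_trans; rewrite lee_fin.
move=> e /= e0 be.
have [t [bt tb]] : exists t, b < t < b + 1 /\ box (b + 1 + B) `<=` (fun m => orthant m -> (t%:E < beta G m)%E).
  have d0 : 0 < Num.min (e / 2) 2^-1 :> R by rewrite lt_min divr_gt0//= invr_gt0.
  exists (b + Num.min (e / 2) 2^-1); split.
    by rewrite ltrDl d0 ltrD2l gt_min invf_lt1// ltr1n orbT.
  apply: be => /=; last by rewrite ltrDl.
  rewrite opprD addrA subrr sub0r normrN gtr0_norm//.
  by rewrite gt_min ltr_pdivrMr// ltr_pMr// ltr1n.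
have : (t%:E <= beta_min G)%E.
  apply: le_ereal_inf_tmp => _ [m m0 <-].
  have [mB|mB] := leP (vec_total m) (b + 1 + B).
    by apply/ltW/tb => //; exact: orthant_box.
  apply: le_trans (BP m m0); rewrite lee_fin; move: mB; have /andP[] := bt; lra.
by rewrite bE lee_fin leNgt; have /andP[-> _] := bt.
Unshelve. all: by end_near. Qed.

End Costs.

(** * Large deviations bounds *)

Lemma ln_prod (R : realType) (I : finType) (F : I -> R) : (forall i, 0 < F i) ->
  ln (\prod_i F i) = \sum_i ln (F i).
Proof.
move=> F0; rewrite -[RHS]expRK expR_sum; congr ln.
by apply: eq_bigr => i _; rewrite lnK// posrE.
Qed.

(** * Upper bound, and the weight of one lattice point *)

Section Bounds.
Variables (R : realType) (N : network R) (U : route N -> R -> R).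
Let G i := window_fun (U i).
Variable d : route N -> nat -> R.
Hypothesis d_bounded : forall i, exists B : R, forall c, (0 < c)%N -> `|d i c| <= B.
Hypothesis d_finite : forall i c k, (0 < c)%N ->
  0 <= window_arg (d i) c k /\ G i (window_arg (d i) c k) \is a fin_num.

Definition shift (c : nat) i := d i c / c%:R.

Definition state_weight (c : nat) (s : state N) : R :=
  weight (fun i n => expR (scaled_window (G i) (d i) c n)) (val s).

Definition unnormalized_law (c : nat) (D : set (vec N)) : \bar R :=
  (\esum_(s in [set s | D (scaled_counts c s)]) (state_weight c s)%:E)%E.

Lemma shift_ge0 c i : (0 < c)%N -> 0 <= shift c i.
Proof. by move=> c0; have [+ _] := d_finite i 0 c0; rewrite /window_arg mul0r add0r. Qed.

Lemma shift_cvg0 i : (fun c => shift c i) @ \oo --> 0.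
Proof.
have [B Bd] := d_bounded i.
have h (b : R) : (fun c : nat => b * (c%:R)^-1) @ \oo --> 0.
  by rewrite -[X in _ --> X](mulr0 b); apply: cvgMr; exact: cvg_inv_nat.
apply: (squeeze_cvgr _ (h (- B)) (h B)).
exists 1%N => // c /= c0; have ci : 0 <= (c%:R : R)^-1 by rewrite invr_ge0.
by rewrite /shift !ler_wpM2r//; move: (Bd c c0); rewrite ler_norml => /andP[].
Qed.

Lemma window_scaled_fin c (s : state N) i : (0 < c)%N ->
  G i (window_total (scaled_counts c s) i + shift c i) \is a fin_num.
Proof. by move=> c0; rewrite window_total_scaled; have [] := d_finite i (in_flight (val s) i) c0. Qed.

Lemma scaled_orthant c (s : state N) : orthant (scaled_counts c s).
Proof. by move=> k; rewrite divr_ge0. Qed.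

Lemma state_weight_cost c s : (0 < c)%N -> state_weight c s =
  expR (- c%:R * shifted_cost U (shift c) (scaled_counts c s)) *
  \prod_j empirical R (val s j).
Proof. exact: weight_scaled. Qed.

Lemma state_weight_gt0 c s : 0 < state_weight c s.
Proof. by apply: weight_gt0 => i k; exact: expR_gt0. Qed.

(** The cost at level [c] has shifted windows, so the bound on [beta] must be carried over to it:
    locally by [affine_cost_near], and from a common [c0] on by compactness. Outside the box
    coercivity already makes the cost exceed [a]. *)
Lemma law_upper (D : set (vec N)) (a eps : R) : D `<=` @orthant R N ->
  (forall m, closure D m -> orthant m -> (a%:E < beta G m)%E) -> 0 < eps ->
  \forall c \near \oo, (unnormalized_law c D <= (expR (- c%:R * (a - eps)))%:E)%E.
Proof.
move=> Dpos Dbeta eps0; have [lam0 [B BP]] := affine_cost_coercive U.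
pose K := box (a + B) `&` closure D.
have Kc : compact K by apply: compact_closedI; [exact: box_compact|exact: closed_closure].
have /compact_near_coveringP/(_ nat \oo (fun c m =>
  (forall i, G i (window_total m i + shift c i) \is a fin_num) ->
  a < shifted_cost U (shift c) m)) := Kc.
move=> /(_ _)[].
  move=> m [/box_orthant m0 /Dbeta/(_ m0)/(beta_gt_affine m0)[lam am]].
  have [AV AVmc AVP] := @affine_cost_near R N U lam m a nat \oo _ (fun i c => shift c i) am shift_cvg0.
  exists AV => // -[m' c] /= mc fG; apply: lt_le_trans (AVP (m', c) mc) _.
  exact: affine_cost_le.
move=> c0 _ c0P.
(* With [T] the total, the cost exceeds both [a] and [T - B] up to equality, hence is at least [(1 -
   theta) * a + theta * (T - B) = a + theta * T - theta * (a + B)]. This [theta] makes the loss at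
   most [eps / 2], and [theta * T] makes the sum over states converge. *)
pose theta := Num.min 1 (eps / 2 / (`|a + B| + 1)).
have th0 : 0 < theta by rewrite lt_min ltr01 !divr_gt0// ltr_pwDr.
have th1 : theta <= 1 by rewrite ge_min lexx.
have thB : theta * (a + B) <= eps / 2.
  apply: (@le_trans _ _ (theta * (`|a + B| + 1))).
    by rewrite ler_pM2l// (le_trans (ler_norm _))// lerDl.
  by rewrite -ler_pdivlMr ?ltr_pwDr// ge_min lexx orbT.
have [S SP] := @sum_empirical R (route N) theta th0.
pose f (j : queue N) (w : seq (route N)) := empirical R w * expR (- theta * (size w)%:R).
have f0 j w : 0 <= f j w by rewrite mulr_ge0 ?empirical_ge0 ?expR_ge0.
pose M := \prod_(j : queue N) S.
have MP : (\esum_(s in [set: state N]) (\prod_j f j (val s j))%:E <= M%:E)%E.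
  by apply: esum_state_le => // j L; exact: SP.
near=> c.
have c_gt0 : (0 < c)%N by near: c; exact: nbhs_infty_gt.
have cR : 0 < c%:R :> R by rewrite ltr0n.
have cost_gt (s : state N) : D (scaled_counts c s) ->
    a < shifted_cost U (shift c) (scaled_counts c s).
  move=> Ds; have x0 := @scaled_orthant c s.
  have fin i := window_scaled_fin s i c_gt0.
  have [le|gt] := leP (vec_total (scaled_counts c s)) (a + B).
    have c0c : (c0 <= c)%N by near: c; exact: nbhs_infty_ge.
    apply: (c0P c c0c) => //; split; first exact: orthant_box.
    exact: subset_closure.
  apply: lt_le_trans (affine_cost_le lam0 fin).
  apply: lt_le_trans (BP _ _ x0 (fun i => shift_ge0 i c_gt0)).
  by rewrite ltrBrDr.
have w_le (s : state N) : D (scaled_counts c s) ->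
    state_weight c s <= expR (- c%:R * (a - eps / 2)) * \prod_j f j (val s j).
  move=> Ds; rewrite state_weight_cost// /f big_split/= [X in _ <= _ * X]mulrC [leRHS]mulrA.
  apply: ler_wpM2r; first by apply: prodr_ge0 => j _; exact: empirical_ge0.
  rewrite -expR_sum -expRD ler_expR -mulr_sumr.
  have -> : \sum_j (size (val s j))%:R = c%:R * vec_total (scaled_counts c s) :> R.
    rewrite vec_total_queue mulr_sumr; apply: eq_bigr => j _.
    by rewrite queue_total_scaled mulrC divfK// gt_eqF.
  have -> : - c%:R * (a - eps / 2) + - theta * (c%:R * vec_total (scaled_counts c s)) =
     - c%:R * (a - eps / 2 + theta * vec_total (scaled_counts c s)) by ring.
  rewrite !mulNr lerN2 ler_pM2l//.
  have lo := cost_gt s Ds.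
  have hi : vec_total (scaled_counts c s) - B <= shifted_cost U (shift c) (scaled_counts c s).
    apply: le_trans (affine_cost_le lam0 (fun i => window_scaled_fin s i c_gt0)).
    by apply: BP => [|i]; [exact: scaled_orthant|exact: shift_ge0].
  move: lo hi thB; set x := shifted_cost _ _ _; set T := vec_total _ => lo hi thB'.
  apply: (@le_trans _ _ ((1 - theta) * a + theta * (T - B))); first by move: thB'; lra.
  have -> : x = (1 - theta) * x + theta * x by ring.
  by rewrite lerD// ler_wpM2l ?subr_ge0// ltW.
apply: (@le_trans _ _ ((expR (- c%:R * (a - eps / 2)))%:E * M%:E)%E).
  apply: le_trans (lee_wpmul2l _ MP); last by rewrite lee_fin expR_ge0.
  rewrite -esumZl ?expR_ge0//; last by move=> s; rewrite lee_fin prodr_ge0.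
  apply: esum_le => r ur rD.
  apply: le_trans (@sum_le_esum R (state N) setT (fun s =>
    (expR (- c%:R * (a - eps / 2)))%:E * (\prod_j f j (val s j))%:E)%E r ur _) => //.
  rewrite big_seq [leRHS]big_seq; apply: lee_sum => s sr.
  by rewrite -EFinM lee_fin; apply: w_le; exact: rD.
(* The other [eps / 2] absorbs the constant [M] for large [c]. *)
have -> : - c%:R * (a - eps) = - c%:R * (a - eps / 2) + eps / 2 * c%:R by lra.
rewrite -EFinM lee_fin expRD ler_pM2l ?expR_gt0//.
apply: (@le_trans _ _ (1 + eps / 2 * c%:R)); last exact: expR_ge1Dx.
apply: (@le_trans _ _ (eps / 2 * c%:R)); last by rewrite lerDr.
rewrite -ler_pdivrMl ?divr_gt0//; near: c; exact: nbhs_infty_ger.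
Unshelve. all: by end_near. Qed.

Lemma state_weight_counts c (s : state N) (m : incidence N -> nat) : (0 < c)%N ->
  (forall k, packets (val s) (val k).1 (val k).2 = m k) ->
  state_weight c s = expR (c%:R * \sum_i fine (G i (window_total (fun k => (m k)%:R / c%:R : R) i + shift c i))
     - \sum_k (m k)%:R * ln (capacity (val k).1)).
Proof.
move=> c0 sm; rewrite state_weight_cost// empirical_log -expRD; congr expR.
have E : scaled_counts c s = (fun k => (m k)%:R / c%:R : R).
  by apply/funext => k; rewrite /scaled_counts sm.
have := queue_cost_scaled s c0; rewrite sum_state_incidence.
rewrite (eq_bigr (fun k => (m k)%:R * ln (capacity (val k).1))); last by move=> k _; rewrite sm.
rewrite /shifted_cost -E => H.
set F := \sum_i fine _; set L := log_likelihood s in H *.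
have -> : L = c%:R * queue_cost (scaled_counts c s) - \sum_k (m k)%:R * ln (capacity (val k).1).
  by rewrite -H; ring.
by ring.
Qed.

Section LatticePoint.
Variable m : incidence N -> nat.

Let n j i : nat := if insub (j, i) is Some k then m k else 0%N.

(** Stirling from below for the queue lengths and from above for the counts. The linear terms
    cancel, since the counts add up to the length; pairs outside [incidence] contribute
    [1 * ln 1 = 0]. *)
Lemma lattice_ln_permutations :
  \sum_j queue_total (fun k => (m k)%:R : R) j * ln (queue_total (fun k => (m k)%:R : R) j)
  - \sum_k (m k).+1%:R * ln (m k).+1%:R <=
  ln (\prod_j (size (permutations (sample_word n j)))%:R : R).
Proof.
have pos j : 0 < (size (permutations (sample_word n j)))%:R :> R.
  rewrite ltr0n lt0n; apply/eqP => sz0.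
  have := multinomial_permutations (sample_word n j); rewrite sz0 mul0n => /esym/eqP.
  by rewrite -leqn0 leqNgt fact_gt0.
rewrite ln_prod => [|j]; last exact: pos.
have n_path j i : j \notin route_path i -> n j i = 0%N.
  by move=> ji; rewrite /n insubF//; exact: negbTE.
have nk (k : incidence N) : n (val k).1 (val k).2 = m k.
  by rewrite /n -surjective_pairing valK.
have sz j : (size (sample_word n j))%:R = queue_total (fun k => (m k)%:R : R) j.
  rewrite -sum_count natr_sum /queue_total.
  transitivity (\sum_j' \sum_i if j' == j then (n j' i)%:R else 0 : R).
    rewrite (bigD1 j)//= eqxx [X in _ + X]big1 ?addr0; last first.
      by move=> j' /negPf j'j; rewrite big1// => i _; rewrite j'j.
    by apply: eq_bigr => i _; rewrite count_sample_word.
  rewrite sum_incidence; last by move=> j' i j'i; case: ifP => // _; rewrite n_path.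
  by rewrite [RHS]big_mkcond; apply: eq_bigr => k _; rewrite nk.
have -> : \sum_k (m k).+1%:R * ln (m k).+1%:R =
    \sum_j \sum_i (n j i).+1%:R * ln (n j i).+1%:R :> R.
  rewrite sum_incidence; last by move=> j i /n_path ->; rewrite ln1 mulr0.
  by apply: eq_bigr => k _; rewrite nk.
rewrite -sumrB; apply: ler_sum => j _.
have := congr1 (fun x => ln (x%:R : R)) (multinomial_permutations (sample_word n j)).
have fpos i : 0 < ((count_mem i (sample_word n j))`!%:R : R) by rewrite ltr0n fact_gt0.
rewrite /= natrM lnM ?posrE ?pos// natr_prod ?prodr_gt0// ln_prod//.
have := ln_fact_ge R (size (sample_word n j)); rewrite sz.
have : \sum_i ln (count_mem i (sample_word n j))`!%:R <=
    \sum_i ((n j i).+1%:R * ln (n j i).+1%:R - (n j i)%:R) :> R.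
  by apply: ler_sum => i _; rewrite count_sample_word ln_fact_le.
rewrite sumrB.
have -> : \sum_i (n j i)%:R = queue_total (fun k => (m k)%:R : R) j.
  by rewrite -sz -sum_count natr_sum; apply: eq_bigr => i _; rewrite count_sample_word.
by lra.
Qed.

Lemma lattice_lower c (D : set (vec N)) : (0 < c)%N ->
  D (fun k => (m k)%:R / c%:R) ->
  ((expR (c%:R * \sum_i fine (G i (window_total (fun k => (m k)%:R / c%:R : R) i + shift c i))
     - \sum_k (m k)%:R * ln (capacity (val k).1)
     + \sum_j queue_total (fun k => (m k)%:R : R) j * ln (queue_total (fun k => (m k)%:R : R) j)
     - \sum_k (m k).+1%:R * ln (m k).+1%:R))%:E <= unnormalized_law c D)%E.
Proof.
move=> c0 Dm; set v0 := _ - \sum_k (m k)%:R * _.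
have n_path j i : j \notin route_path i -> n j i = 0%N.
  by move=> ji; rewrite /n insubF//; exact: negbTE.
apply: (@le_trans _ _ (expR v0 * \prod_j (size (permutations (sample_word n j)))%:R)%:E); last first.
  apply: esum_state_ge => // [s|s sn]; first exact/ltW/state_weight_gt0.
  have sm k : packets (val s) (val k).1 (val k).2 = m k.
    by rewrite sn /n -surjective_pairing valK.
  split; last exact: state_weight_counts.
  rewrite /= (_ : scaled_counts c s = fun k => (m k)%:R / c%:R)//.
  by apply/funext => k; rewrite /scaled_counts sm.
rewrite lee_fin -addrA expRD ler_pM2l ?expR_gt0//.
have P0 : 0 < \prod_j (size (permutations (sample_word n j)))%:R :> R.
  apply: prodr_gt0 => j _; rewrite ltr0n lt0n; apply/eqP => sz0.
  have := multinomial_permutations (sample_word n j); rewrite sz0 mul0n => /esym/eqP.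
  by rewrite -leqn0 leqNgt fact_gt0.
rewrite -[leRHS]lnK ?posrE// ler_expR; exact: lattice_ln_permutations.
Qed.

End LatticePoint.

End Bounds.

(** * Lower bound at a lattice point *)

Section LowerBound.
Variables (R : realType) (N : network R) (U : route N -> R -> R).
Let G i := window_fun (U i).
Variable d : route N -> nat -> R.
Hypothesis regG : forall i, regular_window (G i).
Hypothesis d_bounded : forall i, exists B : R, forall c, (0 < c)%N -> `|d i c| <= B.
Hypothesis d_finite : forall i c k, (0 < c)%N ->
  0 <= window_arg (d i) c k /\ G i (window_arg (d i) c k) \is a fin_num.

Lemma beta_fin_windows (m : vec N) : orthant m -> (beta G m < +oo)%E ->
  forall i, G i (window_total m i) \is a fin_num.
Proof.
move=> m0; rewrite betaE// => boo.
have : \sum_i G i (window_total m i) \is a fin_num.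
  rewrite fin_numE; apply/andP; split; last first.
    by rewrite lt_eqF// lte_sum_pinfty// => i _; exact: window_neq_pinfty.
  by apply: contraTN boo => /eqP ->; rewrite ltxx.
by move=> /sum_fin_numP + i; apply => //; exact: mem_index_enum.
Qed.

Lemma truncn_cvg (x : R) : 0 <= x ->
  (fun c : nat => (Num.truncn (c%:R * x))%:R / c%:R : R) @ \oo --> x.
Proof.
move=> x0; apply: (squeeze_cvgr _ (_ : (fun c : nat => x - c%:R^-1) @ \oo --> x) (cvg_cst x)).
  exists 1%N => // c /= c0; have cR : 0 < c%:R :> R by rewrite ltr0n.
  have /truncn_itv/andP[lo hi] : 0 <= c%:R * x by rewrite mulr_ge0.
  rewrite ler_pdivrMr// [x * _]mulrC lo andbT ler_pdivlMr// mulrBl mulVf ?gt_eqF//.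
  by rewrite [x * _]mulrC lerBlDr natr1 ltW.
by rewrite -[X in _ --> X]subr0; apply: cvgB; [exact: cvg_cst|exact: cvg_inv_nat].
Qed.

Lemma law_lower (D : set (vec N)) (x : vec N) (b eps : R) : orthant x ->
  within (@orthant R N) (nbhs x) D -> (beta G x <= b%:E)%E -> 0 < eps ->
  \forall c \near \oo, ((expR (- c%:R * (b + eps)))%:E <= unnormalized_law U d c D)%E.
Proof.
move=> x0 Dx xb eps0.
have fG : forall i, G i (window_total x i) \is a fin_num.
  by apply: beta_fin_windows => //; exact: le_lt_trans xb (ltry _).
pose m (c : nat) (k : incidence N) : nat := Num.truncn (c%:R * x k).
pose y (c : nat) : vec N := fun k => (m c k)%:R / c%:R.
(* The upper Stirling bound evaluates at counts plus one; [z c] has the same limit as [y c]. *)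
pose z (c : nat) (k : incidence N) : R := (m c k).+1%:R / c%:R.
have y0 c : orthant (y c) by move=> k; rewrite divr_ge0.
have yx k : (fun c => y c k) @ \oo --> x k := truncn_cvg (x0 k).
have y_cvg : y @ \oo --> x.
  apply/cvg_sup => k V [B [[A oA <-] Ax] BV]; apply: (filterS BV).
  exact: (yx k A (open_nbhs_nbhs (conj oA Ax))).
have zx k : (fun c => z c k) @ \oo --> x k.
  rewrite -[X in _ --> X]addr0.
  have := cvgD (yx k) (@cvg_inv_nat R) => /(_ _); apply: cvg_trans; apply: near_eq_cvg.
  by apply: nearW => c; rewrite /z /y -natr1 mulrDl mul1r.
(* The queue cost with its Stirling corrections. Taking [c] out of the logarithms leaves terms in
   [ln c] that cancel except for one per incidence, whence the last summand. *)
pose H c := \sum_k y c k * ln (capacity (val k).1) + \sum_k z c k * ln (z c k)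
  - \sum_j queue_total (y c) j * ln (queue_total (y c) j)
  + #|{: incidence N}|%:R * (ln c%:R / c%:R).
have Hx : H @ \oo --> queue_cost x.
  rewrite -[X in _ --> X]addr0 -[X in _ --> _ + X](mulr0 #|{: incidence N}|%:R).
  have sumcvg (I : finType) (f : I -> nat -> R) (l : I -> R) :
      (forall i, f i @ \oo --> l i) -> (fun c => \sum_i f i c) @ \oo --> \sum_i l i.
    move=> fl; apply: (@cvg_big R I +%R 0 predT _ nat \oo (index_enum I) f l).
      exact: add_continuous.
    by move=> i _; exact: fl.
  apply: cvgD; last by apply: cvgMr; exact: cvg_ln_div.
  apply: cvgB; first apply: cvgD.
  - by apply: sumcvg => k; apply: cvgMl; exact: yx.
  - apply: (sumcvg _ (fun k c => z c k * ln (z c k)) (fun k => x k * ln (x k))) => k.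
    exact: (cvg_comp _ _ (zx k) (@continuous_xln R (x k))).
  - apply: (sumcvg _ (fun j c => queue_total (y c) j * ln (queue_total (y c) j))
      (fun j => queue_total x j * ln (queue_total x j))) => j.
    have qj := cvg_comp _ _ y_cvg (@continuous_queue_total R N j x).
    exact: (cvg_comp _ _ qj (@continuous_xln R (queue_total x j))).
pose del := eps / 2 / #|route N|.+1%:R.
have del0 : 0 < del by rewrite !divr_gt0.
have Gnear i : \forall c \near \oo, fine (G i (window_total x i)) - del <=
    fine (G i (window_total (y c) i + shift d c i)).
  apply: (@window_lower R (U i) (regG i) nat \oo _
    (fun c => window_total (y c) i + shift d c i) (window_total x i) del) => //.
  - by apply: sumr_ge0 => k _; exact: x0.
  - exact: fG.
  - rewrite -[X in _ --> X]addr0; apply: cvgD; last exact: shift_cvg0 d_bounded i.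
    exact: (cvg_comp _ _ y_cvg (@continuous_window_total R N i x)).
  exists 1%N => // c /= c0; split.
    rewrite addr_ge0 ?(shift_ge0 d_finite)//.
    by apply: sumr_ge0 => k _; exact: y0.
  (* A lattice point has integer window contents, so its shifted windows are among those that
     [d_finite] makes finite. *)
  have -> : window_total (y c) i + shift d c i =
      window_arg (d i) c (\sum_(k : incidence N | (val k).2 == i) m c k)%N.
    by rewrite /window_arg /shift natr_sum mulr_suml.
  by have [] := d_finite i (\sum_(k : incidence N | (val k).2 == i) m c k)%N c0.
have Gall := filter_forall _ Gnear.
have Dnear : \forall c \near \oo, D (y c).
  have h : \forall c \near \oo, orthant (y c) -> D (y c) := y_cvg _ Dx.
  by apply: filterS h => c; apply; exact: y0.
near=> c.
have c0 : (0 < c)%N by near: c; exact: nbhs_infty_gt.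
have cR : 0 < c%:R :> R by rewrite ltr0n.
have Dy : D (y c) by near: c.
have Hc : H c < queue_cost x + eps / 2.
  by near: c; apply: (cvgr_lt _ Hx); rewrite ltrDl divr_gt0.
have Gc : \sum_i fine (G i (window_total x i)) - eps / 2 <=
    \sum_i fine (G i (window_total (y c) i + shift d c i)).
  apply: (@le_trans _ _ (\sum_i (fine (G i (window_total x i)) - del))).
    rewrite sumrB sumr_const lerD2l lerN2 -[leLHS]mulr_natr.
    have h : del * #|{: route N}|%:R <= eps / 2; last exact: h.
    by rewrite /del mulrAC ler_pdivrMr// ler_pM2l ?divr_gt0// ler_nat.
  apply: ler_sum => i _; move: i; near: c; exact: Gall.
have bE : queue_cost x - \sum_i fine (G i (window_total x i)) <= b.
  rewrite -lee_fin EFinB -sumEFin; under eq_bigr do rewrite fineK//.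
  by rewrite -betaE.
apply: le_trans (lattice_lower U d c0 Dy); rewrite lee_fin ler_expR.
have lnc0 : c%:R != 0 :> R by rewrite gt_eqF.
have Zln : \sum_k (m c k).+1%:R * ln (m c k).+1%:R =
    c%:R * \sum_k z c k * ln (z c k) + ln c%:R * \sum_k (m c k).+1%:R :> R.
  rewrite !mulr_sumr -big_split/=; apply: eq_bigr => k _.
  by rewrite /z ln_div ?posrE//; field.
have Qln : \sum_j queue_total (fun k => (m c k)%:R : R) j * ln (queue_total (fun k => (m c k)%:R : R) j) =
    c%:R * \sum_j queue_total (y c) j * ln (queue_total (y c) j)
    + ln c%:R * \sum_k (m c k)%:R :> R.
  have -> : \sum_k (m c k)%:R = \sum_j queue_total (fun k => (m c k)%:R : R) j.
    exact: (vec_total_queue (fun k => (m c k)%:R : R)).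
  rewrite !mulr_sumr -big_split/=; apply: eq_bigr => j _.
  have -> : queue_total (y c) j = queue_total (fun k => (m c k)%:R : R) j / c%:R.
    by rewrite /queue_total mulr_suml.
  set q := queue_total _ _.
  have [->|q0] := eqVneq q 0; first by rewrite !mul0r !mulr0 addr0.
  have q1 : 0 < q by rewrite lt_neqAle eq_sym q0 sumr_ge0.
  by rewrite ln_div ?posrE//; field.
have Cln : \sum_k (m c k)%:R * ln (capacity (val k).1) =
    c%:R * \sum_k y c k * ln (capacity (val k).1) :> R.
  by rewrite mulr_sumr; apply: eq_bigr => k _; rewrite /y; field.
have Kln : \sum_k (m c k).+1%:R = \sum_k (m c k)%:R + #|{: incidence N}|%:R :> R.
  under eq_bigr do rewrite -natr1.
  by rewrite big_split/= sumr_const.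
rewrite Zln Qln Cln Kln.
pose F := \sum_i fine (G i (window_total (y c) i + shift d c i)).
set h1 := \sum_k y c k * _; set h2 := \sum_k z c k * _.
set h3 := \sum_j queue_total (y c) j * _.
set M := (\sum_k (m c k)%:R : R); set k := (#|_|%:R : R).
suff : - c%:R * (b + eps) <=
  c%:R * F - c%:R * h1 + (c%:R * h3 + ln c%:R * M) - (c%:R * h2 + ln c%:R * (M + k)) by [].
have -> : c%:R * F - c%:R * h1 + (c%:R * h3 + ln c%:R * M) - (c%:R * h2 + ln c%:R * (M + k))
   = - c%:R * (H c - F) by rewrite /H -/h1 -/h2 -/h3 -/k; field.
rewrite -/F in Gc.
rewrite !mulNr lerN2 ler_pM2l//.
by move: Hc Gc bE; lra.
Unshelve. all: by end_near. Qed.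

End LowerBound.

(** * Limits in the extended reals and the subspace topology *)

Lemma limn_esup_le_near (R : realType) (u : nat -> \bar R) (l : \bar R) :
  (\forall n \near \oo, (u n <= l)%E) -> (limn_esup u <= l)%E.
Proof.
move=> [n0 _ ul]; rewrite limn_esup_lim; apply: lime_le; first exact: is_cvg_esups.
exists n0 => // n /= n0n; apply: ge_ereal_sup => _ [k /= nk <-].
by apply: ul => /=; exact: leq_trans n0n nk.
Qed.

Lemma limn_einf_ge_near (R : realType) (u : nat -> \bar R) (l : \bar R) :
  (\forall n \near \oo, (l <= u n)%E) -> (l <= limn_einf u)%E.
Proof.
move=> ul; rewrite /limn_einf leeNr; apply: limn_esup_le_near.
by apply: filterS ul => n; rewrite leeN2.
Qed.

Lemma ereal_le_forall_lt (R : realType) (x y : \bar R) :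
  (forall a : R, (a%:E < y)%E -> (x <= (- a)%:E)%E) -> (x <= - y)%E.
Proof.
move=> H; rewrite leeNr; case: y H => [r||] H.
- apply/lee_subgt0Pr => e e0; rewrite leeNr -EFinB -EFinN; apply: H.
  by rewrite lte_fin ltrBlDr ltrDl.
- case: x H => [r||] H //=; last by have := H 0 (ltry _).
  have := H (1 - r) (ltry _); rewrite lee_fin {H} => rr; exfalso.
  by move: rr; lra.
- by rewrite leNye.
Qed.

Lemma closure_subspace (T : topologicalType) (X D : set T) (x : T) : D `<=` X ->
  closure D x -> X x -> closure (D : set (subspace X)) x.
Proof.
move=> DX clx Xx V; rewrite -[nbhs _]/(nbhs_subspace (x : subspace X)) -nbhs_subspace_in// => VX.
have [y [Dy Vy]] := clx _ VX.
by exists y; split=> //; exact: (Vy (DX _ Dy)).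
Qed.

Lemma interior_subspace (T : topologicalType) (X D : set T) (x : T) : D `<=` X ->
  interior (D : set (subspace X)) x -> X x /\ within X (nbhs x) D.
Proof.
move=> DX intx; have Xx : X x by apply: DX; exact: (nbhs_singleton intx).
by split=> //; rewrite nbhs_subspace_in//; exact: intx.
Qed.


(** * Normalization and the large deviations principle *)

Section LargeDeviationsPrinciple.
Variables (R : realType) (N : network R) (U : route N -> R -> R).
Let G i := window_fun (U i).
Variable d : route N -> nat -> R.
Hypothesis regG : forall i, regular_window (G i).
Hypothesis d_bounded : forall i, exists B : R, forall c, (0 < c)%N -> `|d i c| <= B.
Hypothesis d_finite : forall i c k, (0 < c)%N ->
  0 <= window_arg (d i) c k /\ G i (window_arg (d i) c k) \is a fin_num.

Lemma beta_minimum : exists2 m, @orthant R N m &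
  beta G m = beta_min G /\ beta_min G \is a fin_num.
Proof.
(* Every route has a queue, so the all-ones vector has positive window totals, where regularity
   makes the windows finite. *)
apply: beta_minimizer; exists (fun=> 1) => [k|]; first exact: ler01.
rewrite betaE => [|k]; last exact: ler01.
have fG i : G i (window_total (fun=> 1) i) \is a fin_num.
  have [f _ _ _ _] := regG i; have [[c [c0 E]]|none] := pselect (exists c : nat,
    (0 < c)%N /\ window_total (fun _ : incidence N => 1 : R) i = c%:R).
    by rewrite E; apply: f; rewrite ltr0n.
  case: none; exists #|[pred k : incidence N | (val k).2 == i]|; split; last by rewrite /window_total sumr_const.
  apply/card_gt0P; have fi : first_queue i \in route_path i := mem_head _ _.
  by exists (exist _ (first_queue i, i) fi); rewrite inE.
rewrite (eq_bigr (fun i => (fine (G i (window_total (fun=> 1) i)))%:E)).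
  by rewrite sumEFin -EFinB ltry.
by move=> i _; rewrite fineK//; exact: fG.
Qed.

Variables (p : nat -> state N -> R) (a : nat -> R).
Hypothesis a_gt0 : forall c, (0 < c)%N -> 0 < a c.
Hypothesis p_weight : forall c s, (0 < c)%N -> p c s = a c * state_weight U d c s.
Hypothesis p_sum1 : forall c, (0 < c)%N -> (\esum_(s in [set: state N]) (p c s)%:E = 1)%E.

Lemma scaled_lawE c D : (0 < c)%N ->
  scaled_law (p c) c D = ((a c)%:E * unnormalized_law U d c D)%E.
Proof.
move=> c0; rewrite /scaled_law /unnormalized_law -esumZl; first last.
- by move=> s; rewrite lee_fin ltW// state_weight_gt0.
- exact/ltW/a_gt0.
by apply: eq_esum => s _; rewrite p_weight// EFinM.
Qed.

Lemma scaled_law_orthant c : (0 < c)%N -> scaled_law (p c) c (@orthant R N) = 1%E.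
Proof.
move=> c0; rewrite -(p_sum1 c0) /scaled_law; congr esum.
by apply/seteqP; split=> // s _; exact: scaled_orthant.
Qed.

(** The orthant has probability 1, so [a c] is the inverse of its total weight, which the upper and
    lower bounds enclose. *)
Lemma normalization (eps : R) : 0 < eps -> \forall c \near \oo,
  expR (c%:R * (fine (beta_min G) - eps)) <= a c <= expR (c%:R * (fine (beta_min G) + eps)).
Proof.
move=> eps0; have [x x0 [xmin fmin]] := beta_minimum.
set b := fine (beta_min G); have bE : beta_min G = b%:E by rewrite fineK.
have eps2 : 0 < eps / 2 by rewrite divr_gt0.
(* [law_upper] wants [beta] strictly above its level, hence [b - eps / 2] in place of [b]. *)
have up := @law_upper R N U d d_bounded d_finite (@orthant R N) (b - eps / 2) (eps / 2) (fun _ => id) _ eps2.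
have lo := @law_lower R N U d regG d_bounded d_finite (@orthant R N) x b eps x0 _ _ eps0.
near=> c.
have c0 : (0 < c)%N by near: c; exact: nbhs_infty_gt.
have a0 := a_gt0 c0; have := scaled_law_orthant c0; rewrite scaled_lawE// => aZ.
have : (unnormalized_law U d c (@orthant R N) <= (expR (- c%:R * (b - eps / 2 - eps / 2)))%:E)%E.
  near: c; apply: up => m _ m0; apply: (@lt_le_trans _ _ b%:E).
    by rewrite lte_fin ltrBlDr ltrDl.
  by rewrite -bE; apply: ereal_inf_lbound; exists m.
have : ((expR (- c%:R * (b + eps)))%:E <= unnormalized_law U d c (@orthant R N))%E.
  near: c; apply: lo; last by rewrite xmin bE.
  exact: withinT.
move: aZ; case: (unnormalized_law U d c _) => [Z||]; last 2 first.
- by rewrite gt0_muley ?lte_fin.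
- by rewrite gt0_muleNy ?lte_fin.
rewrite -EFinM => -[aZ]; rewrite !lee_fin => loZ upZ.
have Z0 : 0 < Z by exact: lt_le_trans (expR_gt0 _) loZ.
have -> : a c = Z^-1 by apply: (mulIf (lt0r_neq0 Z0)); rewrite aZ mulVf// gt_eqF.
have E (v : R) : expR v = (expR (- v))^-1 by rewrite expRN invrK.
rewrite (E (_ * (b - eps))) (E (_ * (b + eps))).
rewrite !lef_pV2 ?posrE ?expR_gt0// -!mulNr loZ andbT.
by apply: le_trans upZ _; rewrite ler_expR; lra.
Unshelve. all: by end_near. Qed.

Lemma scaled_large_deviations : large_deviations (@orthant R N)
  (fun c => scaled_law (p c) c) (fun m => (beta G m - beta_min G)%E).
Proof.
have [x0 x0_0 [x0min fmin]] := beta_minimum.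
set b := fine (beta_min G); have bE : beta_min G = b%:E by rewrite fineK.
have min_le m : orthant m -> (b%:E <= beta G m)%E.
  by move=> m0; rewrite -bE; apply: ereal_inf_lbound; exists m.
split.
  split=> [m m0|r]; first by rewrite bE sube_ge0// min_le.
  rewrite [X in compact X](_ : _ = [set m | orthant m /\ (beta G m <= (r + b)%:E)%E]).
    exact: beta_sublevel_compact.
  by apply/seteqP; split=> m [m0 mr]; split=> //; move: mr;
    rewrite bE EFinD (leeBlDr (beta G m) r%:E (isT : b%:E \is a fin_num)).
move=> D DX _ u.
have u_le c v : (0 < c)%N -> (scaled_law (p c) c D <= (expR (c%:R * v))%:E)%E -> (u c <= v%:E)%E.
  move=> c0 le; have cR : 0 < c%:R :> R by rewrite ltr0n.
  have ci : (0 <= (c%:R^-1)%:E :> \bar R)%E by rewrite lee_fin invr_ge0.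
  have law0 : (0 <= scaled_law (p c) c D)%E.
    by apply: esum_ge0 => s _; rewrite lee_fin p_weight// mulr_ge0 ?ltW ?a_gt0 ?state_weight_gt0.
  apply: (@le_trans _ _ ((c%:R^-1)%:E * lne (expR (c%:R * v))%:E)%E).
    by rewrite lee_wpmul2l// lee_lne// in_itv/= ?law0 ?leey// lee_fin expR_ge0.
  by rewrite lne_EFin ?expR_gt0// expRK -EFinM lee_fin mulKf// gt_eqF.
have u_ge c v : (0 < c)%N -> ((expR (c%:R * v))%:E <= scaled_law (p c) c D)%E -> (v%:E <= u c)%E.
  move=> c0 le; have cR : 0 < c%:R :> R by rewrite ltr0n.
  have ci : (0 <= (c%:R^-1)%:E :> \bar R)%E by rewrite lee_fin invr_ge0.
  have law0 : (0 <= scaled_law (p c) c D)%E by apply: le_trans le; rewrite lee_fin expR_ge0.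
  apply: (@le_trans _ _ ((c%:R^-1)%:E * lne (expR (c%:R * v))%:E)%E); last first.
    by rewrite lee_wpmul2l// lee_lne// in_itv/= ?law0 ?leey// lee_fin expR_ge0.
  by rewrite lne_EFin ?expR_gt0// expRK -EFinM lee_fin mulKf// gt_eqF.
split; [|exact: limn_einf_sup|]; last first.
(* Testing with reals [r] below the infimum also covers an infinite one. Half of [eps] goes to the
   unnormalized law, half to the normalization. *)
- apply: ereal_le_forall_lt => r rJ; apply/lee_addgt0Pr => eps eps0; rewrite -EFinD.
  apply: limn_esup_le_near; have eps2 : 0 < eps / 2 by rewrite divr_gt0.
  have up : \forall c \near \oo,
      (unnormalized_law U d c D <= (expR (- c%:R * (r + b - eps / 2)))%:E)%E.
    apply: (law_upper d_bounded d_finite DX) eps2 => m clm m0.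
    have : (r%:E < beta G m - beta_min G)%E.
      apply: lt_le_trans rJ _; apply: ereal_inf_lbound; exists m => //.
      exact: closure_subspace.
    by rewrite bE lteBrDr.
  have norm := normalization eps2.
  near=> c; have c0 : (0 < c)%N by near: c; exact: nbhs_infty_gt.
  have a0 := a_gt0 c0; apply: u_le => //; rewrite scaled_lawE//.
  have -> : c%:R * (- r + eps) = c%:R * (b + eps / 2) + - c%:R * (r + b - eps / 2) by lra.
  rewrite expRD EFinM; apply: (@le_trans _ _ ((a c)%:E * (expR (- c%:R * (r + b - eps / 2)))%:E)%E).
    by rewrite lee_wpmul2l ?lee_fin ?(ltW a0)//; near: c.
  rewrite -!EFinM lee_fin ler_wpM2r ?expR_ge0//.
  by have /andP[] : expR (c%:R * (b - eps / 2)) <= a c <= expR (c%:R * (b + eps / 2)) by near: c.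
- rewrite leeNl; apply: le_ereal_inf_tmp => _ [m intm <-]; rewrite leeNl.
  have [m0 mD] := interior_subspace DX intm.
  have := min_le m m0; case bm : (beta G m) => [v||] // _; last by rewrite bE /= leNye.
  rewrite bE -EFinB -EFinN; apply/lee_subgt0Pr => eps eps0; rewrite -EFinB.
  apply: limn_einf_ge_near; have eps2 : 0 < eps / 2 by rewrite divr_gt0.
  have lo : \forall c \near \oo,
      ((expR (- c%:R * (v + eps / 2)))%:E <= unnormalized_law U d c D)%E.
    by apply: (law_lower regG d_bounded d_finite m0 mD) eps2; rewrite bm.
  have norm := normalization eps2.
  near=> c; have c0 : (0 < c)%N by near: c; exact: nbhs_infty_gt.
  have a0 := a_gt0 c0; apply: u_ge => //; rewrite scaled_lawE//.
  have -> : c%:R * (- (v - b) - eps) = c%:R * (b - eps / 2) + - c%:R * (v + eps / 2) by lra.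
  rewrite expRD EFinM; apply: (@le_trans _ _ ((a c)%:E * (expR (- c%:R * (v + eps / 2)))%:E)%E).
    rewrite -!EFinM lee_fin ler_wpM2r ?expR_ge0//.
    by have /andP[] : expR (c%:R * (b - eps / 2)) <= a c <= expR (c%:R * (b + eps / 2)) by near: c.
  by rewrite lee_wpmul2l ?lee_fin ?(ltW a0)//; near: c.
Unshelve. all: by end_near. Qed.

End LargeDeviationsPrinciple.

Theorem theorem5p2 (R : realType) (N : network R)
  (U : route N -> R -> R)
  (utilU : forall i, is_utility (U i))
  (assumption1 : forall i,
     strictly_concave_on setT (fun lam => U i (expR lam)))
  (G : route N -> R -> \bar R)
  (defG : forall i m, G i m = window_fun (U i) m)
  (assumption2 : forall i, regular_window (G i))
  (d : route N -> nat -> R)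
  (d_bounded : forall i, exists B : R, forall c, (0 < c)%N -> `|d i c| <= B)
  (d_finite : forall i c k, (0 < c)%N ->
     0 <= window_arg (d i) c k /\ G i (window_arg (d i) c k) \is a fin_num)
  (P : nat -> R -> state N -> state N -> R)
  (chainP : forall c, (0 < c)%N ->
     is_network_chain (fun i => injection_rate (G i) (d i) c) (P c))
  (p : nat -> state N -> R)
  (statp : forall c, (0 < c)%N -> is_stationary (P c) (p c)) :
  (exists2 m, @orthant R N m & beta G m = beta_min G) /\
  large_deviations (@orthant R N) (fun c => scaled_law (p c) c)
    (fun m => (beta G m - beta_min G)%E).
Proof.
have GE : G = fun i => window_fun (U i).
  by apply/funext => i; apply/funext => m; exact: defG.
rewrite {}GE {G defG} in assumption2 d_finite chainP *.
split; first by have [m m0 [mE _]] := beta_minimum assumption2; exists m.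
have scale c : exists a : R, (0 < c)%N ->
    0 < a /\ forall s, p c s = a * state_weight U d c s.
  case: (posnP c) => [->|c0]; first by exists 0.
  (* The exponentials of the scaled windows have the injection rates as their successive ratios. *)
  have [||||a a0 pa] := @stationary_weight R N
    (fun i => injection_rate (window_fun (U i)) (d i) c)
    (fun i n => expR (scaled_window (window_fun (U i)) (d i) c n)) _ _ _
    (P c) (p c) (chainP c c0) (statp c c0)
    (fun i => injection_rate (window_fun (U i)) (d i) c 0).
  - by move=> i k; exact: expR_gt0.
  - by move=> i k; rewrite /injection_rate -expRD addrC subrK.
  - by move=> i k; exact: expR_gt0.
  - by move=> i k; apply: injection_rate_le => // k'; have [] := d_finite i c k' c0.
  by exists a.
have [a aP] := choice scale.
apply: (@scaled_large_deviations R N U d assumption2 d_bounded d_finite p a).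
- by move=> c /aP[].
- by move=> c s /aP[_].
- by move=> c c0; have [[_ +] _] := statp c c0.
Qed.
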